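(* Let $E$ be a Dedekind complete Banach lattice. Then the lattice multi-norm based on $E$ is generated by the family $\mathcal K$ of band decompositions of $E$, and the multi-dual multi-norm with respect to $\mathcal K$ is the lattice multi-norm based on $E'$.
   Context: A Banach lattice is here the complexification $E=E_{\mathbb R}\oplus iE_{\mathbb R}$ of a real Banach lattice $E_{\mathbb R}$, with modulus $|x+iy|=\bigvee\{x\cos\theta+y\sin\theta:0\le\theta\le2\pi\}$ and norm $\|z\|=\|\,|z|\,\|$. $E$ is Dedekind complete if every non-empty subset of $E_{\mathbb R}$ that is bounded above has a supremum. The dual $E'$ is a Banach lattice for the usual dual order. The lattice multi-norm based on a Banach lattice $F$ is $\|(y_1,\dots,y_n)\|_n^L=\|\,|y_1|\vee\cdots\vee|y_n|\,\|$ for $n\in\mathbb N$ and $y_1,\dots,y_n\in F$. A direct sum decomposition $E=E_1\oplus\cdots\oplus E_n$ into closed subspaces (some possibly $\{0\}$), of length $n$, with associated projections $P_i:E\to E_i$, is a band decomposition if each $E_i$ is a band (order-closed order-ideal) in $E$, equivalently if $|x|\wedge|y|=0$ whenever $x\in E_i$, $y\in E_j$ and $i\ne j$. The multi-norm generated by the family $\mathcal K$ is $\|(x_1,\dots,x_n)\|_n^{\mathcal K}=\sup\|P_1x_1+\cdots+P_nx_n\|$ $(x_1,\dots,x_n\in E)$, the supremum being over all decompositions $E=E_1\oplus\cdots\oplus E_n$ in $\mathcal K$ of length $n$. For each decomposition $E=E_1\oplus\cdots\oplus E_n$ in $\mathcal K$, there is a dual decomposition $E'=E_1'\oplus\cdots\oplus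 E_n'$, where $\lambda\in E_i'$ is identified with $\lambda\circ P_i\in E'$; the family of these is $\mathcal K'$. The multi-dual multi-norm with respect to $\mathcal K$ is the multi-norm based on $E'$ generated by $\mathcal K'$, that is, $\|(\lambda_1,\dots,\lambda_n)\|_{n,\mathcal K}^{\dagger}=\sup\|\lambda_1\circ P_1+\cdots+\lambda_n\circ P_n\|$ $(\lambda_1,\dots,\lambda_n\in E')$, the supremum being over all decompositions $E=E_1\oplus\cdots\oplus E_n$ in $\mathcal K$ of length $n$. *)

(* Defs.v *)
From HB Require Import structures.
From mathcomp Require Import all_boot all_order all_algebra.
From mathcomp Require Import all_classical all_reals all_analysis.
From mathcomp Require Import complex.
From mathcomp Require Import ring lra.
Set Implicit Arguments.
Unset Strict Implicit.
Unset Printing Implicit Defensive.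
Import Order.TTheory GRing.Theory Num.Theory.
Import numFieldNormedType.Exports.
Local Open Scope classical_set_scope.
Local Open Scope ring_scope.

(* Real Banach lattices.  The order is given by fields rather than inherited from
   [Order.Lattice] because the Num hierarchy already joins orders and modules
   without a common ancestor for lattices and modules; [vord V] below is [V]
   seen as a [latticeType]. *)
HB.mixin Record isBanachLattice (R : realType) V
    of CompleteNormedModule R V := {
  vle : rel V ;
  vmeet : V -> V -> V ;
  vjoin : V -> V -> V ;
  vle_refl : reflexive vle ;
  vle_anti : antisymmetric vle ;
  vle_trans : transitive vle ;
  vmeetP : forall x y z, vle x (vmeet y z) = vle x y && vle x z ;
  vjoinP : forall x y z, vle (vjoin x y) z = vle x z && vle y z ;
  vle_add2l : forall z x y, vle x y -> vle (z + x) (z + y) ;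
  vscale_ge0 : forall (a : R) x, 0 <= a -> vle 0 x -> vle 0 (a *: x) ;
  vnorm_le : forall x y,
    vle (vjoin x (- x)) (vjoin y (- y)) -> `|x| <= `|y|
}.

#[short(type="banachLatticeType")]
HB.structure Definition BanachLattice (R : realType) :=
  {V of isBanachLattice R V & CompleteNormedModule R V}.

Definition vord (R : realType) (V : banachLatticeType R) : Type := V.
Fact vord_display : Order.disp_t. Proof. exact: Order.Disp tt tt. Qed.

HB.instance Definition _ (R : realType) (V : banachLatticeType R) :=
  Choice.on (vord V).
HB.instance Definition _ (R : realType) (V : banachLatticeType R) :=
  Order.Le_isPOrder.Build vord_display (vord V)
    (@vle_refl R V) (@vle_anti R V) (@vle_trans R V).
HB.instance Definition _ (R : realType) (V : banachLatticeType R) :=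
  Order.POrder_MeetJoin_isLattice.Build vord_display (vord V)
    (@vmeetP R V) (@vjoinP R V).

Definition vabs (R : realType) (V : banachLatticeType R) (x : V) : V :=
  vjoin x (- x).

Section RieszSpace.
Variables (R : realType) (V : banachLatticeType R).
Implicit Types (x y z u : V) (a : R).

Lemma vle_subr x y : vle x y = vle 0 (y - x).
Proof.
apply/idP/idP => [/(vle_add2l (- x))|/(vle_add2l x)].
  by rewrite addNr addrC.
by rewrite addr0 addrCA subrr addr0.
Qed.

Lemma vle_add x y z u : vle x y -> vle z u -> vle (x + z) (y + u).
Proof.
move=> xy zu; apply: (@vle_trans _ _ (x + u)); first exact: vle_add2l.
by rewrite ![_ + u]addrC; exact: vle_add2l.
Qed.

Lemma vadd_ge0 x y : vle 0 x -> vle 0 y -> vle 0 (x + y).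
Proof. by move=> x0 y0; rewrite -[0]addr0; exact: vle_add. Qed.

Lemma vle_opp x y : vle x y -> vle (- y) (- x).
Proof. by rewrite (vle_subr x) (vle_subr (- y)) opprK addrC. Qed.

Lemma vle_scale a x y : 0 <= a -> vle x y -> vle (a *: x) (a *: y).
Proof.
by move=> a0; rewrite (vle_subr x) (vle_subr (a *: x)) -scalerBr; exact: vscale_ge0.
Qed.

Lemma vjoin_l x y : vle x (vjoin x y).
Proof. by have := vjoinP x y (vjoin x y); rewrite vle_refl => /esym/andP[]. Qed.

Lemma vjoin_r x y : vle y (vjoin x y).
Proof. by have := vjoinP x y (vjoin x y); rewrite vle_refl => /esym/andP[]. Qed.

Lemma vmeet_l x y : vle (vmeet x y) x.
Proof. by have := vmeetP (vmeet x y) x y; rewrite vle_refl => /esym/andP[]. Qed.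

Lemma vmeet_r x y : vle (vmeet x y) y.
Proof. by have := vmeetP (vmeet x y) x y; rewrite vle_refl => /esym/andP[]. Qed.

Lemma vjoin_add z x y : z + vjoin x y = vjoin (z + x) (z + y).
Proof.
apply: vle_anti; apply/andP; split; last first.
  by rewrite vjoinP !vle_add2l// (vjoin_l, vjoin_r).
rewrite -[vle _ _]/(vle _ _) -(addKr (- z) (vjoin (z + x) _)) opprK.
apply: vle_add2l; rewrite vjoinP; apply/andP; split.
  by rewrite -[X in vle X _](addKr z); apply: vle_add2l; exact: vjoin_l.
by rewrite -[X in vle X _](addKr z); apply: vle_add2l; exact: vjoin_r.
Qed.

Definition vpos x := vjoin x 0.
Definition vneg x := vjoin 0 (- x).

Lemma vpos_ge0 x : vle 0 (vpos x). Proof. exact: vjoin_r. Qed.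
Lemma vneg_ge0 x : vle 0 (vneg x). Proof. exact: vjoin_l. Qed.

Lemma vposBneg x : vpos x = x + vneg x.
Proof. by rewrite /vneg vjoin_add addr0 subrr. Qed.

Lemma vdecomp x : x = vpos x - vneg x.
Proof. by rewrite vposBneg addrK. Qed.

Lemma vabs_ge0 x : vle 0 (vabs x).
Proof.
have h : vle 0 (vabs x + vabs x).
  by rewrite -[0](subrr x); apply: vle_add; [exact: vjoin_l|exact: vjoin_r].
have := @vscale_ge0 _ V 2^-1 _ (ltac:(by rewrite invr_ge0)) h.
rewrite scalerDr -scalerDl (_ : 2^-1 + 2^-1 = 1) ?scale1r//.
by rewrite -[2^-1]mul1r -splitr.
Qed.

Lemma vabs_id x : vle 0 x -> vabs x = x.
Proof.
move=> x0; apply: vle_anti; rewrite vjoin_l andbT vjoinP vle_refl /=.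
by apply: vle_trans (x0); rewrite -[X in vle _ X]oppr0; exact: vle_opp.
Qed.

Lemma vabsN x : vabs (- x) = vabs x.
Proof.
by apply: vle_anti; rewrite /vabs opprK !vjoinP !(vjoin_l, vjoin_r).
Qed.

Lemma vabs_le x y : vle x y -> vle (- x) y -> vle (vabs x) y.
Proof. by move=> h1 h2; rewrite vjoinP h1. Qed.

Lemma vnorm_vabs x : `|vabs x| = `|x|.
Proof.
by apply/eqP; rewrite eq_le !vnorm_le//;
  rewrite -/(vabs (vabs x)) -/(vabs x) (vabs_id (vabs_ge0 x)) vle_refl.
Qed.

Lemma vnorm_ge0_le x y : vle 0 x -> vle x y -> `|x| <= `|y|.
Proof.
move=> x0 xy; apply: vnorm_le.
by rewrite -/(vabs x) -/(vabs y) !vabs_id//; exact: vle_trans xy.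
Qed.

Lemma vnorm_vpos x : `|vpos x| <= `|x|.
Proof.
rewrite -(vnorm_vabs x); apply: vnorm_ge0_le; first exact: vpos_ge0.
by rewrite vjoinP vjoin_l vabs_ge0.
Qed.

Lemma vnorm_vneg x : `|vneg x| <= `|x|.
Proof.
rewrite -(vnorm_vabs x); apply: vnorm_ge0_le; first exact: vneg_ge0.
by rewrite vjoinP vjoin_r vabs_ge0.
Qed.

Lemma riesz_decomp x y u : vle 0 x -> vle 0 y -> vle 0 u -> vle u (x + y) ->
  exists u1 u2, [/\ u = u1 + u2, vle 0 u1, vle u1 x, vle 0 u2 & vle u2 y].
Proof.
move=> x0 y0 u0 uxy; exists (vmeet u x), (u - vmeet u x); split.
- by rewrite addrC subrK.
- by rewrite vmeetP u0.
- exact: vmeet_r.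
- by rewrite -vle_subr; exact: vmeet_l.
- rewrite vle_subr (_ : y - (u - vmeet u x) = vmeet u x - (u - y)); last first.
    by rewrite !opprB addrCA.
  rewrite -vle_subr vmeetP; apply/andP; split.
    by rewrite vle_subr opprB addrC subrK.
  by rewrite vle_subr opprB addrA -vle_subr.
Qed.

End RieszSpace.

Section DualSpace.
Variables (R : realType) (V : banachLatticeType R).

Definition dual_pred : {pred V -> R^o} :=
  [pred f : V -> R^o | `[< linear f /\ continuous f >]].

Record dual : Type := Dual { dual_fun :> V -> R^o ; _ : dual_pred dual_fun }.

HB.instance Definition _ := [isSub for dual_fun].
HB.instance Definition _ := [Choice of dual by <:].

Lemma dual_predP (f : V -> R^o) (C : R) : linear f ->
  (forall x, `|f x| <= C * `|x|) -> dual_pred f.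
Proof.
move=> lf fC; apply/asboolP; split => //.
pose lfm := GRing.isLinear.Build R V R^o *:%R f lf.
pose g : {linear V -> R^o} := HB.pack f lfm.
apply: (@bounded_linear_continuous _ _ _ g); apply/linear_boundedP.
near=> r => x; apply: (le_trans (fC x)); apply: ler_wpM2r => //.
Unshelve. all: by end_near. Qed.

Lemma dual_linear (f : dual) : linear f.
Proof. by case: f => f /= /asboolP[]. Qed.

Lemma dual_bounded (f : dual) :
  exists2 C : R, 0 <= C & forall x, `|f x| <= C * `|x|.
Proof.
case: f => f /= /asboolP[lf cf].
pose lfm := GRing.isLinear.Build R V R^o *:%R f lf.
pose g : {linear V -> R^o} := HB.pack f lfm.
have /linear_boundedP : bounded_near g (nbhs 0) by exact/linear_bounded_continuous.
move=> h; near +oo_R => r; exists r => //.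
by near: r.
Unshelve. all: by end_near. Qed.

Fact dual_submod_closed : submod_closed dual_pred.
Proof.
split.
  apply: (@dual_predP _ 0) => [a x y|x]; last by rewrite normr0 mul0r.
  by rewrite /= scaler0 addr0.
move=> a f g Pf Pg.
have [C _ fC] := dual_bounded (Dual Pf); have [D _ gD] := dual_bounded (Dual Pg).
have E z : (a *: f + g) z = a * f z + g z :> R by [].
apply: (@dual_predP _ (`|a| * C + D)) => [b x y|x].
  have lf : f (b *: x + y) = b * f x + f y :> R := dual_linear (Dual Pf) b x y.
  have lg : g (b *: x + y) = b * g x + g y :> R := dual_linear (Dual Pg) b x y.
  by rewrite !E lf lg /GRing.scale/=; ring.
rewrite E mulrDl; apply: (le_trans (ler_normD _ _)).
apply: lerD; last exact: (gD x).
by rewrite normrM -mulrA; apply: ler_wpM2l => //; exact: (fC x).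
Qed.

HB.instance Definition _ :=
  GRing.isSubmodClosed.Build R (V -> R^o) dual_pred dual_submod_closed.
HB.instance Definition _ := [SubChoice_isSubLmodule of dual by <:].

End DualSpace.

Section DualNorm.
Variables (R : realType) (V : banachLatticeType R).
Implicit Types (f g h : dual V) (x y : V).

Definition dual_norm f : R := sup [set `|f x| | x in [set x : V | `|x| <= 1]].

Lemma dual_ext f g : (forall x, f x = g x) -> f = g.
Proof. by move=> fg; apply: val_inj; apply/funext. Qed.

Lemma dualD f g x : (f + g) x = f x + g x :> R. Proof. by []. Qed.
Lemma dualN f x : (- f) x = - f x :> R. Proof. by []. Qed.
Lemma dualB f g x : (f - g) x = f x - g x :> R. Proof. by []. Qed.
Lemma dualZ (a : R) f x : (a *: f) x = a * f x :> R. Proof. by []. Qed.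

Lemma dual_add f x y : f (x + y) = f x + f y :> R.
Proof. by have := dual_linear f 1 x y; rewrite !scale1r. Qed.

Lemma dual0 f : f 0 = 0 :> R.
Proof.
by apply: (@addrI R (f 0)); rewrite addr0 -{3}[0 : V]addr0 dual_add.
Qed.

Lemma dual_scale f (a : R) x : f (a *: x) = a * f x :> R.
Proof.
have : f (a *: x + 0) = a * f x + f 0 :> R := dual_linear f a x 0.
by rewrite dual0 !addr0.
Qed.

Lemma dual_opp f x : f (- x) = - f x :> R.
Proof. by rewrite -scaleN1r dual_scale mulN1r. Qed.

Lemma dual_sub f x y : f (x - y) = f x - f y :> R.
Proof. by rewrite dual_add dual_opp. Qed.

Lemma dual_norm_has_sup f : has_sup [set `|f x| | x in [set x : V | `|x| <= 1]].
Proof.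
split; first by exists `|f 0|, 0 => //=; rewrite normr0.
have [C C0 fC] := dual_bounded f; exists C => _ [x /= x1 <-].
by apply: le_trans (fC x) _; rewrite -[leRHS]mulr1 ler_wpM2l.
Qed.

Lemma dual_norm_ge0 f : 0 <= dual_norm f.
Proof.
apply: (@le_trans _ _ `|f 0|) => //; apply: ub_le_sup.
  by case: (dual_norm_has_sup f).
by exists 0 => //=; rewrite normr0.
Qed.

Lemma dual_normP f x : `|f x : R| <= dual_norm f * `|x|.
Proof.
have [->|x0] := eqVneq x 0; first by rewrite dual0 !normr0 mulr0.
have nx0 : 0 < `|x| by rewrite normr_gt0.
rewrite -ler_pdivrMr//; apply: ub_le_sup; first by case: (dual_norm_has_sup f).
exists (`|x|^-1 *: x) => /=.
  by rewrite normrZ ger0_norm ?invr_ge0// mulVf// gt_eqF.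
by rewrite dual_scale normrM ger0_norm ?invr_ge0// mulrC.
Qed.

Lemma dual_norm_lub f (C : R) : 0 <= C ->
  (forall x, `|f x : R| <= C * `|x|) -> dual_norm f <= C.
Proof.
move=> C0 fC; apply: ge_sup; first by case: (dual_norm_has_sup f).
move=> _ [x /= x1 <-]; apply: le_trans (fC x) _.
by rewrite -[leRHS]mulr1 ler_wpM2l.
Qed.

Let dual_normD f g : dual_norm (f + g) <= dual_norm f + dual_norm g.
Proof.
apply: dual_norm_lub => [|x]; first by rewrite addr_ge0// dual_norm_ge0.
rewrite dualD mulrDl; apply: le_trans (ler_normD _ _) _.
by apply: lerD; exact: dual_normP.
Qed.

Let dual_normZ_le (a : R) f : dual_norm (a *: f) <= `|a| * dual_norm f.
Proof.
apply: dual_norm_lub => [|x]; first by rewrite mulr_ge0// dual_norm_ge0.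
by rewrite dualZ normrM -mulrA ler_wpM2l// dual_normP.
Qed.

Let dual_normZ (a : R) f : dual_norm (a *: f) = `|a| * dual_norm f.
Proof.
have [->|a0] := eqVneq a 0.
  apply/eqP; rewrite eq_le normr0 mul0r dual_norm_ge0 andbT.
  by apply: le_trans (dual_normZ_le _ _) _; rewrite normr0 mul0r.
apply/eqP; rewrite eq_le dual_normZ_le/=.
rewrite -{1}[f](scalerK a0) -ler_pdivlMl ?normr_gt0// -normfV.
exact: dual_normZ_le.
Qed.

Let dual_norm0_eq0 f : dual_norm f = 0 -> f = 0.
Proof.
move=> f0; apply: dual_ext => x; apply/eqP; rewrite -normr_eq0 eq_le normr_ge0.
by rewrite andbT; have := dual_normP f x; rewrite f0 mul0r.
Qed.

HB.instance Definition _ := Lmodule_isNormed.Build R (dual V)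
  dual_normD dual_normZ dual_norm0_eq0.

Lemma dual_normE f : `|f| = dual_norm f. Proof. by []. Qed.

Let dual_complete (F : set_system (dual V)) :
  ProperFilter F -> cauchy F -> cvg F.
Proof.
move=> FF /cauchy_ballP Fc.
have small (e : R) : 0 < e ->
    exists2 A, F A & forall f h, A f -> A h -> `|f - h| < e.
  move=> e0; have [[A B] /= [FA FB] AB] := Fc e e0.
  exists (A `&` B) => [|f h [Af _] [_ Bh]]; first exact: filterI.
  by have := AB (f, h) (conj Af Bh); rewrite /= -ball_normE.
have ptw x : cvg ((fun f : dual V => f x : R) @ F).
  apply: cauchy_cvg; apply/cauchy_ballP => e e0.
  have [A FA Ae] := small (e / (`|x| + 1)) (ltac:(by rewrite divr_gt0// ltr_wpDl)).
  exists ((fun f : dual V => f x : R) @` A, (fun f : dual V => f x : R) @` A).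
    by split; rewrite /= /nbhs/=; apply: (@filterS _ F _ A) => // f Af; exists f.
  move=> [_ _] /= [[f Af <-] [h Ah <-]]; rewrite -ball_normE /ball_/= -dualB.
  apply: (le_lt_trans (dual_normP _ _)).
  have := Ae _ _ Af Ah; rewrite dual_normE ltr_pdivlMr ?ltr_wpDl//.
  apply: le_lt_trans; rewrite ler_wpM2l ?dual_norm_ge0// lerDl//.
pose g x : R := lim ((fun f : dual V => f x : R) @ F).
have gl : linear (g : V -> R^o).
  move=> b x y; apply/esym.
  rewrite /GRing.scale/=.
  have h1 : (fun f : dual V => f (b *: x + y) : R) @ F --> b * g x + g y.
    rewrite (_ : (fun f : dual V => f (b *: x + y) : R) =
        (fun f : dual V => b * (f x : R) + (f y : R))); last first.
      by apply/funext => f; rewrite dual_add dual_scale.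
    by apply: cvgD; [apply: cvgMr; exact: ptw|exact: ptw].
  exact: (cvg_unique _ h1 (ptw _)).
have est (e : R) A : F A -> (forall f h, A f -> A h -> `|f - h| < e) ->
    forall f, A f -> forall x, `|(f x : R) - g x| <= e * `|x|.
  move=> FA Ae f Af x; apply/ler_addgt0Pr => d d0.
  have /cvgrPdist_lt/(_ d d0) Fd := ptw x.
  have [h [Ah /= hd]] := @filter_ex _ F _ _ (filterI FA Fd).
  rewrite (_ : (f x : R) - g x = (f - h) x + (h x - g x)); last first.
    by rewrite dualB; ring.
  apply: le_trans (ler_normD _ _) _; apply: lerD.
    apply: le_trans (dual_normP _ _) _; rewrite ler_wpM2r//.
    exact/ltW/Ae.
  by rewrite distrC; exact: ltW.
have Pg : dual_pred (g : V -> R^o).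
  have [A FA Ae] := small 1 ltr01.
  have [f Af] := @filter_ex _ F _ _ FA.
  apply: (@dual_predP _ _ _ (dual_norm f + 1)) => // x.
  rewrite mulrDl mul1r (_ : g x = f x - (f x - g x)); last by ring.
  apply: le_trans (ler_normB _ _) _; apply: lerD; first exact: dual_normP.
  by have := est _ _ FA Ae f Af x; rewrite mul1r.
apply/cvg_ex; exists (Dual Pg); apply/cvgrPdist_le => e e0.
have [A FA Ae] := small e e0; apply: (filterS _ (FA)) => f Af.
rewrite distrC; apply: dual_norm_lub => [|x]; first exact: ltW.
by rewrite dualB; exact: (est e A FA Ae f Af x).
Qed.

HB.instance Definition _ := Uniform_isComplete.Build (dual V) dual_complete.

End DualNorm.

Section DualLattice.
Variables (R : realType) (V : banachLatticeType R).
Implicit Types (f g h : dual V) (x y u : V).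

Let interval_image f x : set R :=
  [set (f u : R) | u in [set u : V | vle 0 u /\ vle u x]].
Let pos f x : R := sup (interval_image f x).

Let pos_has_sup f x : vle 0 x -> has_sup (interval_image f x).
Proof.
move=> x0; split; first by exists (f 0), 0 => //=; rewrite vle_refl.
exists (dual_norm f * `|x|) => _ [u /= [u0 ux] <-].
apply: le_trans (ler_norm _) _; apply: le_trans (dual_normP f u) _.
by rewrite ler_wpM2l ?dual_norm_ge0// vnorm_ge0_le.
Qed.

Let le_pos f x u : vle 0 u -> vle u x -> (f u : R) <= pos f x.
Proof.
move=> u0 ux; apply: ub_le_sup; last by exists u.
by case: (@pos_has_sup f x) => //; exact: vle_trans ux.
Qed.

Let pos_le f x (c : R) : vle 0 x ->
  (forall u, vle 0 u -> vle u x -> (f u : R) <= c) -> pos f x <= c.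
Proof.
move=> x0 fc; apply: ge_sup; first by case: (@pos_has_sup f x).
by move=> _ [u /= [u0 ux] <-]; exact: fc.
Qed.

Let pos_ge0 f x : vle 0 x -> 0 <= pos f x.
Proof. by move=> x0; rewrite -(dual0 f); apply: le_pos => //; exact: vle_refl. Qed.

Let posD f x y : vle 0 x -> vle 0 y -> pos f (x + y) = pos f x + pos f y.
Proof.
move=> x0 y0; apply/eqP; rewrite eq_le; apply/andP; split.
  apply: pos_le => [|u u0 uxy]; first exact: vadd_ge0.
  have [u1 [u2 [-> u10 u1x u20 u2y]]] := riesz_decomp x0 y0 u0 uxy.
  by rewrite dual_add lerD// le_pos.
rewrite -lerBrDr; apply: pos_le => // u u0 ux.
rewrite lerBrDr addrC -lerBrDr; apply: pos_le => // w w0 wy.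
rewrite lerBrDr -dual_add; apply: le_pos; first exact: vadd_ge0.
by rewrite [x + y]addrC; exact: vle_add.
Qed.

Let posZ_le f (a : R) x : 0 < a -> vle 0 x -> a * pos f x <= pos f (a *: x).
Proof.
move=> a0 x0; rewrite -ler_pdivlMl//; apply: pos_le => // u u0 ux.
rewrite ler_pdivlMl// -dual_scale; apply: le_pos.
  exact: vscale_ge0 (ltW a0) u0.
exact: vle_scale (ltW a0) ux.
Qed.

Let posZ f (a : R) x : 0 <= a -> vle 0 x -> pos f (a *: x) = a * pos f x.
Proof.
rewrite le_eqVlt => /predU1P[<- x0|a0 x0].
  rewrite scale0r mul0r; apply/eqP; rewrite eq_le pos_ge0 ?vle_refl// andbT.
  apply: pos_le => [|u u0 u0']; first exact: vle_refl.
  by rewrite (_ : u = 0) ?dual0//; apply: vle_anti; rewrite u0 u0'.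
apply/eqP; rewrite eq_le posZ_le// andbT.
have ax0 := @vscale_ge0 _ V a x (ltW a0) x0.
have := @posZ_le f a^-1 (a *: x) (ltac:(by rewrite invr_gt0)) ax0.
by rewrite scalerK ?gt_eqF// -ler_pdivlMl ?invr_gt0// invrK.
Qed.

Let ext f x : R^o := pos f (vpos x) - pos f (vneg x).

Let extB f x y : vle 0 x -> vle 0 y -> ext f (x - y) = pos f x - pos f y :> R.
Proof.
move=> x0 y0; have : pos f (vpos (x - y) + y) = pos f (x + vneg (x - y)).
  by rewrite vposBneg addrAC subrK.
rewrite !posD ?vpos_ge0 ?vneg_ge0// /ext => h; lra.
Qed.

Let ext_linear f : linear (ext f).
Proof.
move=> a x y; apply: (@etrans _ _ (a * (ext f x : R) + (ext f y : R))) => //.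
have [px nx] := (vpos_ge0 x, vneg_ge0 x).
have [py ny] := (vpos_ge0 y, vneg_ge0 y).
have e : a *: x + y = (a *: vpos x + vpos y) - (a *: vneg x + vneg y).
  by rewrite opprD addrACA -scalerBr -!vdecomp.
have [a0|a0] := leP 0 a.
  rewrite e extB ?posD ?posZ// ?vadd_ge0 ?vscale_ge0// /ext; lra.
have Na0 : 0 <= - a by lra.
have {}e : a *: x + y = (- a *: vneg x + vpos y) - (- a *: vpos x + vneg y).
  rewrite e !scaleNr !opprD !opprK [LHS]addrACA [RHS]addrACA.
  by congr (_ + _); exact: addrC.
rewrite e extB ?posD ?posZ// ?vadd_ge0 ?vscale_ge0// /ext; lra.
Qed.

Let ext_bounded f x : `|ext f x : R| <= dual_norm f *+ 2 * `|x|.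
Proof.
have pos_bounded z : vle 0 z -> `|z| <= `|x| -> `|pos f z| <= dual_norm f * `|x|.
  move=> z0 zx; rewrite ger0_norm ?pos_ge0//; apply: pos_le => // u u0 uz.
  apply: le_trans (ler_norm _) _; apply: le_trans (dual_normP f u) _.
  rewrite ler_wpM2l ?dual_norm_ge0//; apply: le_trans zx.
  exact: vnorm_ge0_le.
rewrite mulrnAl mulr2n; apply: le_trans (ler_normB _ _) _; apply: lerD.
  by apply: pos_bounded; [exact: vpos_ge0|exact: vnorm_vpos].
by apply: pos_bounded; [exact: vneg_ge0|exact: vnorm_vneg].
Qed.

Let dual_pos f : dual V :=
  Dual (dual_predP (@ext_linear f) (@ext_bounded f)).

Let dual_posE f x : vle 0 x -> dual_pos f x = pos f x :> R.
Proof.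
move=> x0; rewrite -[x in LHS]subr0; apply: etrans (extB _ _ _) _ => //.
  exact: vle_refl.
have : pos f (0 *: (0 : V)) = 0 * pos f 0 by apply: posZ => //; exact: vle_refl.
by rewrite scale0r mul0r => ->; rewrite subr0.
Qed.

(* the usual order of the dual; the join [f + (g - f)^+] is given by the
   Riesz-Kantorovich formula *)
Definition dual_le f g := `[< forall x, vle 0 x -> (f x : R) <= g x >].
Definition dual_join f g := f + dual_pos (g - f).
Definition dual_meet f g := - dual_join (- f) (- g).

Let dual_le_refl : reflexive dual_le.
Proof. by move=> f; apply/asboolP. Qed.

Let dual_le_anti : antisymmetric dual_le.
Proof.
move=> f g /andP[/asboolP fg /asboolP gf].
have e x : vle 0 x -> f x = g x :> R.
  by move=> x0; apply/eqP; rewrite eq_le fg// gf.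
apply: dual_ext => x; rewrite (vdecomp x).
by apply: etrans (dual_sub _ _ _) _; rewrite !e ?vpos_ge0 ?vneg_ge0 -?dual_sub.
Qed.

Let dual_le_trans : transitive dual_le.
Proof.
move=> f g h /asboolP gf /asboolP fh; apply/asboolP => x x0.
by apply: le_trans (fh x x0); exact: gf.
Qed.

Let dual_joinP f g h : dual_le (dual_join f g) h = dual_le f h && dual_le g h.
Proof.
apply/idP/andP => [/asboolP jh|[/asboolP fh /asboolP gh]].
  split; apply/asboolP => x x0; apply: le_trans (jh x x0).
    by rewrite dualD dual_posE// lerDl pos_ge0.
  rewrite dualD dual_posE// -lerBlDl -dualB.
  by apply: le_pos => //; exact: vle_refl.
apply/asboolP => x x0; rewrite dualD dual_posE// -lerBrDl.
apply: pos_le => // u u0 ux.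
have := fh (x - u); rewrite -vle_subr => /(_ ux); rewrite !dual_sub.
by have := gh u u0; rewrite dualB; lra.
Qed.

Let dual_le_opp f g : dual_le (- f) (- g) = dual_le g f.
Proof.
by apply/asboolP/asboolP => h x x0; have := h x x0; rewrite !dualN lerN2.
Qed.

Let dual_meetP f g h : dual_le f (dual_meet g h) = dual_le f g && dual_le f h.
Proof.
by rewrite -{1}[f]opprK /dual_meet dual_le_opp dual_joinP !dual_le_opp ?opprK.
Qed.

Let dual_le_add2l h f g : dual_le f g -> dual_le (h + f) (h + g).
Proof.
by move=> /asboolP fg; apply/asboolP => x x0; rewrite !dualD lerD2l fg.
Qed.

Let dual_scale_ge0 (a : R) f : 0 <= a -> dual_le 0 f -> dual_le 0 (a *: f).
Proof.
move=> a0 /asboolP f0; apply/asboolP => x x0; rewrite dualZ mulr_ge0//.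
exact: f0.
Qed.

Let dual_abs_le f h x :
  dual_le f h -> dual_le (- f) h -> `|f x : R| <= h (vabs x).
Proof.
move=> /asboolP fh /asboolP Nfh.
pose a := 2^-1 *: (vabs x + x); pose b := 2^-1 *: (vabs x - x).
have h0 : 0 <= 2^-1 :> R by rewrite invr_ge0.
have a0 : vle 0 a.
  apply: vscale_ge0 => //; rewrite -{2}[x]opprK -vle_subr; exact: vjoin_r.
have b0 : vle 0 b by apply: vscale_ge0 => //; rewrite -vle_subr; exact: vjoin_l.
have h1 : 2^-1 + 2^-1 = 1 :> R by rewrite -[2^-1]mul1r -splitr.
have eabs : vabs x = a + b.
  by rewrite -scalerDr addrACA subrr addr0 scalerDr -scalerDl h1 scale1r.
have ex : x = a - b.
  by rewrite -scalerBr opprB [vabs x + x]addrC addrACA subrr addr0 scalerDr -scalerDl h1 scale1r.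
have -> : f x = f a - f b :> R by rewrite -dual_sub -ex.
rewrite eabs dual_add ler_norml.
have := fh a a0; have := fh b b0; have := Nfh a a0; have := Nfh b b0.
by rewrite !dualN => *; apply/andP; split; lra.
Qed.

Let dual_norm_le f g :
  dual_le (dual_join f (- f)) (dual_join g (- g)) -> `|f| <= `|g|.
Proof.
rewrite dual_joinP => /andP[fg Nfg]; rewrite !dual_normE.
apply: dual_norm_lub => [|x]; first exact: dual_norm_ge0.
apply: le_trans (dual_abs_le x fg Nfg) _; rewrite -(vnorm_vabs x).
have := vabs_ge0 x; move: (vabs x) => w w0.
rewrite dualD dual_posE// -lerBrDl; apply: pos_le => // u u0 uw.
rewrite lerBrDl dualB dualN -opprD -dual_add -dual_sub.
apply: le_trans (ler_norm _) _; apply: le_trans (dual_normP _ _) _.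
rewrite ler_wpM2l ?dual_norm_ge0//; apply: vnorm_le.
rewrite -!/(vabs _) (vabs_id w0); apply: vabs_le.
  by rewrite vle_subr opprB addrCA subrr addr0 vadd_ge0.
rewrite opprB vle_subr opprB addrA opprD addrACA.
by apply: vadd_ge0; rewrite -vle_subr.
Qed.

HB.instance Definition _ := isBanachLattice.Build R (dual V)
  dual_le_refl dual_le_anti dual_le_trans dual_meetP dual_joinP
  dual_le_add2l dual_scale_ge0 dual_norm_le.

End DualLattice.

Definition dedekind_complete (R : realType) (V : banachLatticeType R) : Prop :=
  forall A : set (vord V), A !=set0 -> has_ubound A -> exists s, isLub A s.

(* [(x, y)] stands for [x + iy] *)
Definition cplx (R : realType) (V : banachLatticeType R) : Type := (V * V)%type.

Section Complexification.
Variables (R : realType) (V : banachLatticeType R).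

HB.instance Definition _ := GRing.Zmodule.copy (cplx V) (V * V)%type.

Definition cscale (c : R[i]) (z : cplx V) : cplx V :=
  (complex.Re c *: z.1 - complex.Im c *: z.2,
   complex.Re c *: z.2 + complex.Im c *: z.1).

Let cscaleA a b z : cscale a (cscale b z) = cscale (a * b) z.
Proof.
case: a b z => [a a'] [b b'] [x y]; rewrite /cscale/=; congr (_, _).
  rewrite !scalerBr !scalerDr !scalerA !scalerBl !scalerDl !opprD.
  by rewrite [RHS]addrAC !addrA.
rewrite !scalerBr !scalerDr !scalerA scalerBl scalerDl.
by rewrite [RHS]addrAC !addrA.
Qed.

Let cscale1 z : cscale 1 z = z.
Proof. by case: z => x y; rewrite /cscale/= !scale1r !scale0r subr0 addr0. Qed.

Let cscaleDr c : {morph cscale c : z w / z + w}.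
Proof.
move=> [x y] [x' y']; rewrite /cscale/=; congr (_, _).
  by rewrite !scalerDr opprD addrACA.
by rewrite !scalerDr addrACA.
Qed.

Let cscaleDl z : {morph cscale^~ z : a b / a + b}.
Proof.
move=> [a a'] [b b']; case: z => x y; rewrite /cscale/=; congr (_, _).
  by rewrite !scalerDl opprD addrACA.
by rewrite !scalerDl addrACA.
Qed.

HB.instance Definition _ := GRing.Zmodule_isLmodule.Build R[i] (cplx V)
  cscaleA cscale1 cscaleDr cscaleDl.

Implicit Types (F : set (cplx V)) (z w : cplx V).

(* [supremum] is total with default value [0], but this set has a supremum in
   every Banach lattice. *)
Definition cmodulus z : V :=
  supremum (0 : vord V)
    [set (cos t *: z.1 + sin t *: z.2 : vord V) | t in `[0, 2 * pi]].

Definition cnorm z : R := `|cmodulus z|.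

Lemma cmodulus_real (x : V) : cmodulus (x, 0) = vabs x.
Proof.
rewrite /cmodulus /supremum ifF; last first.
  apply/negbTE/set0P; exists (cos 0 *: x + sin 0 *: 0), 0 => //=.
  by rewrite in_itv/= lexx/= mulr_ge0// pi_ge0.
set A := [set _ | _ in _].
have xA : supremums A (vabs x).
  split => [_ [t _ <-]|b bA]; rewrite /Order.le/=.
    rewrite scaler0 addr0; have [c0|c0] := leP 0 (cos t).
      apply: (@vle_trans _ _ (cos t *: vabs x)).
        by apply: vle_scale => //; exact: vjoin_l.
      rewrite vle_subr -[X in X - _]scale1r -scalerBl.
      by apply: vscale_ge0; [rewrite subr_ge0 cos_le1|exact: vabs_ge0].
    rewrite -[cos t]opprK scaleNr -scalerN.
    have c0' : 0 <= - cos t by rewrite oppr_ge0 ltW.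
    apply: (@vle_trans _ _ (- cos t *: vabs x)).
      by apply: vle_scale => //; exact: vjoin_r.
    rewrite vle_subr -[X in X - _]scale1r -scalerBl.
    apply: vscale_ge0; last exact: vabs_ge0.
    by rewrite subr_ge0 lerNl cos_geN1.
  apply: vabs_le; apply: bA.
    exists 0; first by rewrite /= in_itv/= lexx/= mulr_ge0// pi_ge0.
    by rewrite cos0 scale1r scaler0 addr0.
  exists pi; first by rewrite /= in_itv/= pi_ge0/= ler_peMl ?pi_ge0// ler1n.
  by rewrite cospi scaleN1r scaler0 addr0.
case: xgetP => [y -> yA|/(_ (vabs x))//].
exact: is_subset1_supremums yA xA.
Qed.

Lemma cnorm_real (x : V) : cnorm (x, 0) = `|x|.
Proof. by rewrite /cnorm cmodulus_real vnorm_vabs. Qed.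

Definition csubspace F : Prop :=
  [/\ F 0, forall z w, F z -> F w -> F (z + w)
    & forall (c : R[i]) z, F z -> F (c *: z)].

Definition cclosed F : Prop :=
  forall z, (forall e : R, 0 < e -> exists2 w, F w & cnorm (z - w) < e) -> F z.

Definition order_ideal F : Prop :=
  csubspace F /\ forall z w, vle (cmodulus z) (cmodulus w) -> F w -> F z.

(* order-closedness of the real part of [F]; the case of infima follows by
   taking opposites when [F] is a subspace *)
Definition order_closed F : Prop :=
  forall (D : set (vord V)) (s : vord V), D !=set0 ->
    (forall d, D d -> F (d : V, 0)) -> isLub D s -> F (s : V, 0).

Definition band F : Prop := order_ideal F /\ order_closed F.

(* [P i] is the projection of [E = F 0 + ... + F (n - 1)] onto [F i] *)
Record direct_sum n (F : 'I_n -> set (cplx V)) (P : 'I_n -> cplx V -> cplx V)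
    : Prop := DirectSum {
  direct_sum_subspace : forall i, csubspace (F i) ;
  direct_sum_closed : forall i, cclosed (F i) ;
  direct_sum_mem : forall i z, F i (P i z) ;
  direct_sum_proj : forall z, \sum_i P i z = z ;
  direct_sum_uniq : forall w : 'I_n -> cplx V, (forall i, F i (w i)) ->
    forall i, P i (\sum_j w j) = w i
}.

(* The family of band decompositions of length [n], each one represented by its
   projections [P], of which the [i]-th summand is the range of [P i]. *)
Definition band_decompositions n : set ('I_n -> cplx V -> cplx V) :=
  [set P | exists2 F : 'I_n -> set (cplx V),
     direct_sum F P & forall i, band (F i)].

(* [n.+1] vectors: the join of an empty family of moduli is not defined; the
   unit [cmodulus (y ord0)] of the iterated join is one of its terms. *)
Definition lattice_mnorm n (y : 'I_n.+1 -> cplx V) : R :=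
  `| \big[@vjoin R V/cmodulus (y ord0)]_(i < n.+1) cmodulus (y i) |.

Record cdual : Type := CDual {
  cdual_fun :> {linear cplx V -> R[i]^o} ;
  cdual_bounded : exists C : R, forall z, Normc.normc (cdual_fun z) <= C * cnorm z
}.

Definition cdual_norm (phi : cplx V -> R[i]) : \bar R :=
  ereal_sup [set (Normc.normc (phi z))%:E | z in [set z | cnorm z <= 1]].

Let cdual_real_linear (phi : cdual) (a : R) (x y : V) :
  phi (a *: x + y, 0) = a%:C%C * phi (x, 0) + phi (y, 0) :> R[i].
Proof.
have eZ : a%:C%C *: ((x, 0) : cplx V) = (a *: x, 0).
  by congr (_, _); rewrite /= ?scale0r ?scaler0 ?addr0 ?subr0.
have eD : ((a *: x, 0) : cplx V) + (y, 0) = (a *: x + y, 0).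
  by congr (_, _); rewrite /= addr0.
by rewrite -eD -eZ linearP.
Qed.

Let normc_Re (c : R[i]) : `|complex.Re c| <= Normc.normc c.
Proof.
by case: c => a b /=; rewrite -sqrtr_sqr ler_wsqrtr ?lerDl ?sqr_ge0.
Qed.

Let normc_Im (c : R[i]) : `|complex.Im c| <= Normc.normc c.
Proof.
by case: c => a b /=; rewrite -sqrtr_sqr ler_wsqrtr ?lerDr ?sqr_ge0.
Qed.

Fact cdual_re_subproof (phi : cdual) :
  dual_pred (fun x : V => complex.Re (phi (x, 0)) : R^o).
Proof.
have [C phiC] := cdual_bounded phi.
apply: (@dual_predP _ _ _ C) => [a x y|x].
  rewrite cdual_real_linear; case: (phi (x, 0)) (phi (y, 0)) => [b c] [b' c'].
  by rewrite /GRing.scale/= mul0r subr0.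
by rewrite -cnorm_real; apply: le_trans (phiC _); exact: normc_Re.
Qed.

Fact cdual_im_subproof (phi : cdual) :
  dual_pred (fun x : V => complex.Im (phi (x, 0)) : R^o).
Proof.
have [C phiC] := cdual_bounded phi.
apply: (@dual_predP _ _ _ C) => [a x y|x].
  rewrite cdual_real_linear; case: (phi (x, 0)) (phi (y, 0)) => [b c] [b' c'].
  by rewrite /GRing.scale/= mul0r addr0.
by rewrite -cnorm_real; apply: le_trans (phiC _); exact: normc_Im.
Qed.

End Complexification.

(* The identification of the dual of the complexification of [V] with the
   complexification of the dual of [V]: a functional [phi] is
   [phi1 + i phi2], where [phi1] and [phi2] are the real and imaginary parts
   of its restriction to [V]. *)
Definition cdual_cplx (R : realType) (V : banachLatticeType R)
    (phi : cdual V) : cplx (dual V) :=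
  (Dual (cdual_re_subproof phi), Dual (cdual_im_subproof phi)).

(* [E] is the underlying space, [N] its norm, and [K] a family of
   decompositions of [E] of length [n], given by their projections. *)
Definition generated_mnorm (R : realType) (E : nmodType) (N : E -> \bar R)
    n (K : set ('I_n -> E -> E)) (x : 'I_n -> E) : \bar R :=
  ereal_sup [set N (\sum_i P i (x i)) | P in K].

(* The summand of the dual decomposition indexed by [i] consists of the
   functionals [phi \o P i], so its projection is [phi |-> phi \o P i]; it is
   defined on all [S]-valued functions, and applied to the elements of the dual
   only. *)
Definition dual_decompositions (E S : Type) n (K : set ('I_n -> E -> E)) :
    set ('I_n -> (E -> S) -> (E -> S)) :=
  [set (fun i (phi : E -> S) => phi \o P i) | P in K].

Definition multidual_mnorm (R : realType) (V : banachLatticeType R)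
    n (K : set ('I_n -> cplx V -> cplx V)) (phi : 'I_n -> cdual V) : \bar R :=
  generated_mnorm (@cdual_norm R V) (dual_decompositions K)
    (fun i => phi i : cplx V -> R[i]).

(* Main.v *)
Require Import Defs.
From HB Require Import structures.
From mathcomp Require Import all_boot all_order all_algebra.
From mathcomp Require Import all_classical all_reals all_analysis.
From mathcomp Require Import complex.
From mathcomp Require Import ring lra.
Set Implicit Arguments.
Unset Strict Implicit.
Unset Printing Implicit Defensive.
Import Order.TTheory GRing.Theory Num.Theory.
Import numFieldNormedType.Exports.
Local Open Scope classical_set_scope.
Local Open Scope ring_scope.

(** Band decompositions are the same as finite families of band projections summing to
the identity, acting componentwise on [x + iy].  In a Dedekind complete [V] any finite
family [u_i] admits such a family [q_i] with [\sum_i q_i u_i] above every [u_j]; applied to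
[u_i = |z_i|], it shows that the supremum defining the generated multi-norm is attained
at the join of the moduli.

For the dual, the least upper bound of a bounded set [B] of functionals is
[L x = sup \sum_k b_k (q_k x)] ([x >= 0]) over band partitions [q] and [b_k] in [B].  Only
the superadditivity of [L] is not clear: if [0 <= y <= u], some band projection [Q] makes
[y' = 2 y - Q u] lie between [0] and [u] again, and the defect
[L y + L (u - y) - L u] is at most half the defect of [y'], hence is zero.  For
[B = {Re (c phi_i)}] this formula gives one inequality.  The other one is
[Re phi z <= |phi| |z|], proved by cutting [z] by bands on which its argument is nearly
constant. *)

(** * Band projections *)

Section ConeExtension.
Variables (R : realType) (V : banachLatticeType R).
Implicit Types (x y z u v w : V) (a : R).

Lemma vsubr_ge0 x y : vle 0 (y - x) = vle x y.
Proof. by rewrite (vle_subr x). Qed.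

Lemma vle_addr x y : vle x (x + y) = vle 0 y.
Proof. by rewrite -vsubr_ge0 addrAC subrr add0r. Qed.

Lemma vle_anti_eq x y : vle x y -> vle y x -> x = y.
Proof. by move=> xy yx; apply: vle_anti; rewrite xy yx. Qed.

Lemma vle_sum (I : Type) (s : seq I) (P : pred I) (F G : I -> V) :
  (forall i, P i -> vle (F i) (G i)) ->
  vle (\sum_(i <- s | P i) F i) (\sum_(i <- s | P i) G i).
Proof.
by move=> FG; apply: (big_ind2 (fun x y => vle x y)) => //;
  [exact: vle_refl|exact: vle_add].
Qed.

Lemma vsum_ge0 (I : Type) (s : seq I) (P : pred I) (F : I -> V) :
  (forall i, P i -> vle 0 (F i)) -> vle 0 (\sum_(i <- s | P i) F i).
Proof.
by move=> F0; apply: (big_ind (fun x => vle 0 x)) => //;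
  [exact: vle_refl|exact: vadd_ge0].
Qed.

(** Induction from the two-term Riesz decomposition. It is used to show that the projections of a
    band decomposition are positive. *)
Lemma riesz_decomp_sum (n : nat) (v : 'I_n -> V) x :
  (forall i, vle 0 (v i)) -> vle 0 x -> vle x (\sum_i v i) ->
  exists y : 'I_n -> V,
    x = \sum_i y i /\ forall i, vle 0 (y i) /\ vle (y i) (v i).
Proof.
elim: n v x => [|n IH] v x v0 x0.
  rewrite big_ord0 => x0'; exists (fun=> 0); split; last by case.
  by rewrite big_ord0; exact: vle_anti_eq.
rewrite big_ord_recl => xv.
have [x1 [x2 [-> x10 x1v x20 x2v]]] :=
  riesz_decomp (v0 ord0) (@vsum_ge0 _ _ _ _ (fun i _ => v0 (lift ord0 i))) x0 xv.
have [y [-> yP]] := IH _ _ (fun i => v0 (lift ord0 i)) x20 x2v.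
exists (fun i => if unlift ord0 i is Some j then y j else x1); split.
  rewrite big_ord_recl unlift_none; congr (_ + _).
  by apply: eq_bigr => i _; rewrite liftK.
by move=> i; case: unliftP => [j|] ->.
Qed.

(** The extension is [T (vpos x) - T (vneg x)]: by additivity it takes the value [T x - T y] at
    every difference [x - y] of positive vectors, and a negative scalar exchanges the two parts. The
    target [W] is [V] for band projections and [R^o] for functionals. *)
Lemma cone_extension (W : lmodType R) (T : V -> W) :
  (forall x y, vle 0 x -> vle 0 y -> T (x + y) = T x + T y) ->
  (forall a x, 0 <= a -> vle 0 x -> T (a *: x) = a *: T x) ->
  exists L : {linear V -> W}, forall x, vle 0 x -> L x = T x.
Proof.
move=> TD TZ; pose L x := T (vpos x) - T (vneg x).
have LB x y : vle 0 x -> vle 0 y -> L (x - y) = T x - T y.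
  move=> x0 y0; have : T (vpos (x - y) + y) = T (x + vneg (x - y)).
    by rewrite vposBneg addrAC subrK.
  rewrite !TD ?vpos_ge0 ?vneg_ge0// => h; rewrite /L.
  by apply/eqP; rewrite subr_eq addrAC -h addrK.
have Llin : linear L.
  move=> a x y.
  have [px nx] := (vpos_ge0 x, vneg_ge0 x).
  have [py ny] := (vpos_ge0 y, vneg_ge0 y).
  have e : a *: x + y = (a *: vpos x + vpos y) - (a *: vneg x + vneg y).
    by rewrite opprD addrACA -scalerBr -!vdecomp.
  have [a0|a0] := leP 0 a.
    rewrite e LB ?TD ?TZ// ?vadd_ge0 ?vscale_ge0// /L.
    by rewrite opprD addrACA -scalerBr.
  have Na0 : 0 <= - a by rewrite oppr_ge0 ltW.
  have {}e : a *: x + y = (- a *: vneg x + vpos y) - (- a *: vpos x + vneg y).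
    rewrite e !scaleNr !opprD !opprK [LHS]addrACA [RHS]addrACA.
    by congr (_ + _); exact: addrC.
  rewrite e LB ?TD ?TZ// ?vadd_ge0 ?vscale_ge0// /L.
  by rewrite !scaleNr opprD opprK addrACA [- _ + _]addrC -scalerBr.
pose Lm := GRing.isLinear.Build R V W *:%R L Llin.
pose Ll : {linear V -> W} := HB.pack L Lm.
exists Ll => x x0; rewrite -[LHS]/(L x).
rewrite -[x in LHS]subr0 LB ?vle_refl//.
have := TZ 0 0 (lexx _) (vle_refl _); rewrite !scale0r => ->; exact: subr0.
Qed.

End ConeExtension.

(** * Band projections as linear maps, and the projection onto a principal band *)

Section BandProjection.
Variables (R : realType) (V : banachLatticeType R).
Implicit Types (x y z u v w : V) (a : R) (P Q : {linear V -> V}).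

(** Idempotents between [0] and the identity on the cone are exactly the projections onto projection
    bands; this form avoids mentioning the band. *)
Definition band_projection Q :=
  (forall x, vle 0 x -> vle 0 (Q x) /\ vle (Q x) x) /\
  (forall x, Q (Q x) = Q x).

Lemma lin_le Q : (forall x, vle 0 x -> vle 0 (Q x)) ->
  forall x y, vle x y -> vle (Q x) (Q y).
Proof.
by move=> Q0 x y; rewrite -(vsubr_ge0 x) -(vsubr_ge0 (Q x)) -linearB; exact: Q0.
Qed.

Lemma band_projection_le Q x y :
  band_projection Q -> vle x y -> vle (Q x) (Q y).
Proof. by move=> [Q0 _]; apply: lin_le => z /Q0[]. Qed.

Lemma band_projection_vabs Q x : band_projection Q -> vle (vabs (Q x)) (Q (vabs x)).
Proof.
move=> QP; apply: vabs_le; last rewrite -linearN.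
  by apply: band_projection_le => //; exact: vjoin_l.
by apply: band_projection_le => //; exact: vjoin_r.
Qed.

Lemma band_projection_norm Q x : band_projection Q -> `|Q x| <= `|x|.
Proof.
move=> QP; apply: vnorm_le; apply: vle_trans (band_projection_vabs x QP) _.
exact: (QP.1 _ (vabs_ge0 x)).2.
Qed.

Lemma band_projectionC Q : band_projection Q -> band_projection (idfun \- Q).
Proof.
move=> [Q0 QQ]; split => [x /[dup] x0 /Q0[Qx0 Qx]|x] /=.
  by rewrite vsubr_ge0; split => //; rewrite -vsubr_ge0 opprB addrC subrK.
by rewrite linearB/= QQ subrr subr0.
Qed.

(** For a band projection [A] and [x >= 0], [P (A x)] lies between [0] and [A x], so the complement
    of [A] kills it, and [A P A = P A]. The cases where [A] is [Q] and where it is the complement of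
    [Q] together give [P Q = Q P]. *)
Lemma band_projection_comm P Q : band_projection P -> band_projection Q ->
  forall x, P (Q x) = Q (P x).
Proof.
move=> hP; have key A : band_projection A -> forall x, A (P (A x)) = P (A x).
  move=> hA; have key0 x : vle 0 x -> A (P (A x)) = P (A x).
    move=> x0; apply/esym/eqP; rewrite -subr_eq0; apply/eqP.
    have /proj1 C0 := band_projectionC hA.
    have Ax0 : vle 0 (A x) by have [/(_ _ x0)[]] := hA.
    have [h _] := C0 _ (proj1 (hP.1 _ Ax0)).
    apply: vle_anti_eq h.
    have := band_projection_le (band_projectionC hA) (proj2 (hP.1 _ Ax0)).
    by rewrite /= hA.2 subrr.
  by move=> x; rewrite (vdecomp x) !linearB/= !key0 ?vpos_ge0 ?vneg_ge0.
move=> hQ x.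
have h1 := key _ hQ x; have h2 := key _ (band_projectionC hQ) x.
have /eqP : Q (P (x - Q x)) = 0 by rewrite -h2/= linearB/= hQ.2 subrr.
by rewrite !linearB/= h1 subr_eq0 => /eqP.
Qed.

(** [Q] is the projection onto the band generated by [p = vpos x]. On the cone it is the supremum of
    the parts of a vector dominated by a multiple of [p]; it fixes [p] and kills the negative part
    of [x], which is disjoint from [p]. *)
Lemma band_projection_exists : dedekind_complete V ->
  forall x, exists2 Q, band_projection Q & Q x = vpos x.
Proof.
move=> dcV e; set p := vpos e.
have p0 : vle 0 p := vpos_ge0 e.
pose C x : set (vord V) := [set y | [/\ vle 0 y, vle y x
  & exists2 r : R, 0 <= r & vle y (r *: p)]].
have C0 x : vle 0 x -> C x 0.
  by move=> x0; split; rewrite ?vle_refl//; exists 0; rewrite // scale0r vle_refl.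
have [T TP] : {T : V -> V & forall x, vle 0 x -> isLub (C x) (T x)}.
  apply: (@choice _ _ (fun x (s : vord V) => vle 0 x -> isLub (C x) s)) => x.
  have [x0|x0] := boolP (vle 0 x); last by exists 0.
  have [s sP] := dcV (C x) (ex_intro _ _ (C0 x x0))
    (ex_intro _ x (fun y '(And3 _ h _) => h)).
  by exists s.
have Tub x y : vle 0 x -> C x y -> vle y (T x) by move=> /TP[h _] /h.
have Tle x y : vle 0 x -> (forall z, C x z -> vle z y) -> vle (T x) y.
  by move=> /TP[_ h] zy; apply: h.
have T0 x : vle 0 x -> vle 0 (T x) by move=> x0; apply: (Tub) => //; exact: C0.
have Tx x : vle 0 x -> vle (T x) x by move=> x0; apply: (Tle) => // y [].
have TD x y : vle 0 x -> vle 0 y -> T (x + y) = T x + T y.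
  move=> x0 y0; have xy0 := vadd_ge0 x0 y0; apply: vle_anti_eq.
    apply: (Tle) => // z [z0 zxy [r r0 zr]].
    have [z1 [z2 [ez z10 z1x z20 z2y]]] := riesz_decomp x0 y0 z0 zxy.
    rewrite ez; apply: vle_add; apply: (Tub) => //; split=> //; exists r => //;
      apply: vle_trans zr; rewrite ez.
      by rewrite -vsubr_ge0 addrC addKr.
    by rewrite -vsubr_ge0 addrK.
  rewrite -vsubr_ge0 opprD addrA vsubr_ge0; apply: (Tle) => // z [z0 zy [r r0 zr]].
  rewrite -vsubr_ge0 addrAC vsubr_ge0; apply: (Tle) => // z' [z'0 z'x [r' r'0 z'r]].
  rewrite -vsubr_ge0 addrAC -addrA -opprD vsubr_ge0; apply: (Tub) => //; split.
  - exact: vadd_ge0.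
  - exact: vle_add.
  - by exists (r' + r); [exact: addr_ge0|rewrite scalerDl; exact: vle_add].
have TZle a x : 0 <= a -> vle 0 x -> vle (a *: T x) (T (a *: x)).
  rewrite le_eqVlt => /predU1P[<- x0|a0 x0].
    by rewrite !scale0r; apply/T0/vle_refl.
  rewrite -[X in vle _ X](scalerKV (lt0r_neq0 a0)).
  apply: vle_scale; first exact: ltW.
  have ax0 := vscale_ge0 _ _ (ltW a0) x0.
  apply: (Tle) => // z [z0 zx [r r0 zr]].
  rewrite -[z](scalerK (lt0r_neq0 a0)); apply: vle_scale.
    by rewrite invr_ge0 ltW.
  apply: (Tub) => //; split.
  - exact: vscale_ge0 _ _ (ltW a0) z0.
  - exact: vle_scale (ltW a0) zx.
  - exists (a * r); first by rewrite mulr_ge0// ltW.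
    by rewrite -scalerA; apply: vle_scale (ltW a0) zr.
have TZ a x : 0 <= a -> vle 0 x -> T (a *: x) = a *: T x.
  rewrite le_eqVlt => /predU1P[<- x0|a0 x0].
    rewrite !scale0r; apply: vle_anti_eq; last by apply/T0/vle_refl.
    exact/Tx/vle_refl.
  apply: vle_anti_eq; last exact: TZle (ltW a0) x0.
  rewrite -[X in vle X _](scalerKV (lt0r_neq0 a0)).
  apply: vle_scale; first exact: ltW.
  have := @TZle a^-1 (a *: x); rewrite scalerK ?lt0r_neq0//; apply.
    by rewrite invr_ge0 ltW.
  exact: vscale_ge0 _ _ (ltW a0) x0.
have [Q QP] := cone_extension TD TZ.
have QQ x : vle 0 x -> Q (Q x) = Q x.
  move=> x0; have Tx0 := T0 _ x0; rewrite !QP//; apply: vle_anti_eq; first exact: Tx.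
  apply: (Tle) => // y Cy; apply: (Tub) => //.
  by case: (Cy) => y0 yx ye; split => //; exact: Tub.
exists Q.
  split => x; first by move=> x0; rewrite QP//; split; [exact: T0|exact: Tx].
  by rewrite (vdecomp x) !linearB/= !QQ ?vpos_ge0 ?vneg_ge0.
have Qp : Q p = p.
  rewrite QP//; apply: vle_anti_eq; first exact: Tx.
  apply: (Tub) => //; split; rewrite ?vle_refl//.
  by exists 1; rewrite // scale1r vle_refl.
rewrite (vdecomp e) linearB/= -/p Qp QP ?vneg_ge0// (_ : T _ = 0) ?subr0//.
apply: vle_anti_eq; last by apply/T0/vneg_ge0.
apply: (Tle); [exact: vneg_ge0|move=> y [y0 ye [r r0 yr]]].
(* [z] lies below both [vpos e] and [vneg e], which are disjoint *)
have r1 : 0 < 1 + r by rewrite ltr_pwDl.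
pose z := (1 + r)^-1 *: y.
have z0 : vle 0 z by apply: vscale_ge0 => //; rewrite invr_ge0 ltW.
have yz : y = (1 + r) *: z by rewrite scalerKV ?gt_eqF.
have zp : vle z p.
  rewrite -[p](scalerK (lt0r_neq0 r1)); apply: vle_scale.
    by rewrite invr_ge0 ltW.
  apply: vle_trans yr _; rewrite scalerDl scale1r -vsubr_ge0 addrK//.
have ze : vle z (vneg e).
  apply: vle_trans ye; rewrite yz scalerDl scale1r -vsubr_ge0 addrC addKr.
  exact: vscale_ge0.
(* Since [p] is the join of [e] and [0], it suffices that [p - z] is above both: this is
   [z <= vneg e = p - e] and [z <= p]. Hence [z <= 0]. *)
have : vle p (p - z).
  rewrite vjoinP vsubr_ge0 zp andbT.
  by rewrite /p vposBneg -vsubr_ge0 addrAC (addrC e) addrK vsubr_ge0.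
rewrite -vsubr_ge0 addrAC subrr add0r => Nz0.
rewrite yz (_ : z = 0) ?scaler0 ?vle_refl//; apply: vle_anti_eq z0.
by rewrite -[z]opprK -[0]oppr0; exact: vle_opp.
Qed.

End BandProjection.

(** * Finite band partitions *)

Section BandPartition.
Variables (R : realType) (V : banachLatticeType R).
Implicit Types (x y z u v w : V) (a : R) (P Q : {linear V -> V}) (I J : finType).

(** Each [p i] is then a band projection, see [band_partition_proj]. Arbitrary finite index types
    allow disjoint unions of partitions. *)
Record band_partition I (p : I -> {linear V -> V}) : Prop := BandPartition {
  band_partition_ge0 : forall i x, vle 0 x -> vle 0 (p i x) ;
  band_partition_sum : forall x, \sum_i p i x = x ;
  band_partition_orth : forall i j x, i != j -> p i (p j x) = 0
}.

Lemma band_partition_pick I (p : I -> {linear V -> V}) (w : I -> V) i :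
  band_partition p -> p i (\sum_j p j (w j)) = p i (p i (w i)).
Proof.
move=> pP; rewrite linear_sum/= (bigD1 i)//= big1 ?addr0// => j ji.
by rewrite band_partition_orth// eq_sym.
Qed.

Lemma band_partition_proj I (p : I -> {linear V -> V}) i :
  band_partition p -> band_projection (p i).
Proof.
move=> pP; split => x.
  move=> x0; split; first exact: band_partition_ge0.
  rewrite -{2}[x](band_partition_sum pP) (bigD1 i)//= vle_addr.
  by apply: vsum_ge0 => j _; exact: band_partition_ge0.
by rewrite -{2}[x](band_partition_sum pP) band_partition_pick.
Qed.

Lemma band_partition_le I (p : I -> {linear V -> V}) i x y :
  band_partition p -> vle x y -> vle (p i x) (p i y).
Proof. by move=> pP; apply/band_projection_le/band_partition_proj. Qed.

Lemma band_partition1 I (i0 : I) :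
  band_partition (fun i => if i == i0 then idfun : {linear V -> V}
                          else \0 : {linear V -> V}).
Proof.
split => [i x x0|x|i j x ij].
- by case: ifP => _ //=; exact: vle_refl.
- by rewrite (bigD1 i0)//= eqxx big1 ?addr0// => i /negbTE ->.
- case: eqVneq => // ei; case: eqVneq => // ej.
  by rewrite ei ej eqxx in ij.
Qed.

(** [p] is used on the band of [Q] and [q] on its complement; orthogonality holds because band
    projections commute. *)
Lemma band_partition_glue I J (p : I -> {linear V -> V})
    (q : J -> {linear V -> V}) Q :
  band_partition p -> band_partition q -> band_projection Q ->
  exists r : I + J -> {linear V -> V}, [/\ band_partition r,
    forall i x, r (inl i) x = p i (Q x) &
    forall j x, r (inr j) x = q j (x - Q x)].
Proof.
move=> pP qP QP; have CP := band_projectionC QP.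
exists (fun k => match k with
  | inl i => (p i \o Q : {linear V -> V})
  | inr j => (q j \o (idfun \- Q) : {linear V -> V}) end); split=> //; split.
- move=> [i|j] x x0 /=; apply: band_partition_ge0 => //.
    exact: (proj1 (QP.1 _ x0)).
  exact: (proj1 (CP.1 _ x0)).
- by move=> x; rewrite big_sumType/= !band_partition_sum// addrC subrK.
have pQ i := band_projection_comm (band_partition_proj i pP) QP.
have qQ j := band_projection_comm (band_partition_proj j qP) QP.
move=> [i|i] [j|j] x ij /=.
- by rewrite -pQ band_partition_orth.
- by rewrite -qQ linearB/= QP.2 subrr !linear0.
- by rewrite pQ QP.2 subrr linear0.
- by rewrite -qQ -linearB/= band_partition_orth.
Qed.

(** Merges the blocks that carry the same label, which brings a glued partition back to a prescribed
    index type. *)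
Lemma band_partition_coarsen I J (p : I -> {linear V -> V}) (l : I -> J) :
  band_partition p -> exists P : J -> {linear V -> V},
    band_partition P /\ forall j x, P j x = \sum_(i | l i == j) p i x.
Proof.
move=> pP.
have lin j : linear (fun x => \sum_(i | l i == j) p i x).
  move=> a x y; rewrite scaler_sumr -big_split/=.
  by apply: eq_bigr => i _; rewrite linearP.
pose F j x := \sum_(i | l i == j) p i x.
pose P j : {linear V -> V} :=
  let m := GRing.isLinear.Build R V V *:%R (F j) (lin j) in HB.pack (F j) m.
exists P; split => //; split.
- by move=> j x x0; apply: vsum_ge0 => i _; exact: band_partition_ge0.
- by move=> x; rewrite -[RHS](band_partition_sum pP) (partition_big l xpredT).
- move=> i j x ij; apply: big1 => k /eqP lk; rewrite linear_sum big1// => k' /eqP lk'.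
  by apply: band_partition_orth => //; apply: contra ij => /eqP kk'; rewrite -lk -lk' kk'.
Qed.

Hypothesis dcV : dedekind_complete V.

(** The indices are treated one at a time: on the band where [u j] exceeds the current sum, the sum
    is replaced by [u j]. The index [i0] supplies the initial partition. *)
Lemma band_partition_max I (i0 : I) (u : I -> V) :
  exists2 q, band_partition q & forall j, vle (u j) (\sum_i q i (u i)).
Proof.
suff [q qP qu] : exists2 q, band_partition q &
    forall j, j \in enum I -> vle (u j) (\sum_i q i (u i)).
  by exists q => // j; apply: qu; rewrite mem_enum.
elim: (enum I) => [|j s [q qP qu]]; first by eexists; first exact: band_partition1 i0.
have [Q QP Qu] := band_projection_exists dcV (u j - \sum_i q i (u i)).
have [r [rP rl rr]] := band_partition_glue (band_partition1 (ord0 : 'I_1)) qP QP.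
pose l (k : 'I_1 + I) := match k with inl _ => j | inr i => i end.
have [q' [q'P q'E]] := band_partition_coarsen l rP.
(* With [s] the old sum, the new one is [s + vpos (u j - s)], the join of [s] and [u j]. *)
have e : \sum_i q' i (u i) =
    (\sum_i q i (u i)) + vpos (u j - \sum_i q i (u i)).
  transitivity (\sum_k r k (u (l k))).
    rewrite (partition_big l xpredT)//=; apply: eq_bigr => i _.
    by rewrite q'E; apply: eq_bigr => k /eqP ->.
  rewrite big_sumType/= big_ord1 rl/= -Qu linearB/=.
  have qQ i := band_projection_comm (band_partition_proj i qP) QP.
  under eq_bigr do rewrite rr linearB/= qQ.
  by rewrite big_split/= sumrN -(linear_sum Q) addrCA.
exists q' => // k; rewrite in_cons e => /predU1P[->|/qu ku].
  apply: vle_trans (vle_add2l _ _ _ (vjoin_l _ _)).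
  by rewrite addrC subrK vle_refl.
apply: vle_trans ku _; rewrite vle_addr; exact: vpos_ge0.
Qed.

End BandPartition.

(** * The modulus *)

Section UnitCircle.
Variable R : realType.
Implicit Types a b s t : R.

(** The angle is [acos a] or [2 * pi - acos a] according to the sign of [b]. The modulus can then be
    handled through points of the circle, without angles. *)
Lemma unit_circle_param a b : a ^+ 2 + b ^+ 2 = 1 ->
  exists2 t, t \in `[0, 2 * pi] & cos t = a /\ sin t = b.
Proof.
move=> ab1; have a1 : -1 <= a <= 1.
  by have := sqr_ge0 b => b2; apply/andP; split; nra.
have acosa : cos (acos a) = a by apply: acosK; rewrite in_itv.
have sina : sin (acos a) = `|b|.
  by rewrite sin_acos// -sqrtr_sqr; congr Num.sqrt; lra.
have := acos_ge0 a1; have := acos_lepi a1; have pi0 := pi_ge0 R.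
have [b0|b0] := leP 0 b => aclepi ac0.
  exists (acos a); last by rewrite sina ger0_norm.
  by rewrite in_itv/=; lra.
exists (2 * pi - acos a); first by rewrite in_itv/=; lra.
rewrite addrC (_ : 2 * pi = pi *+ 2) ?mulr_natl// cosD2pi sinD2pi cosN sinN.
by rewrite sina ltr0_norm// opprK.
Qed.

Lemma derive_le1_lipschitz (f df : R -> R) :
  (forall s, is_derive s 1 f (df s)) -> (forall s, `|df s| <= 1) ->
  forall s t, `|f s - f t| <= `|s - t|.
Proof.
move=> fdf df1; suff key : forall s t, s <= t -> `|f t - f s| <= `|t - s|.
  move=> s t; have [st|/ltW ts] := leP s t; last exact: key.
  by rewrite distrC [leRHS]distrC; exact: key.
move=> s t st; have [] := @MVT_segment R f df s t st.
  apply: continuous_subspaceT => x.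
  by apply/differentiable_continuous/derivable1_diffP; case: (fdf x).
by move=> c _ ->; rewrite normrM ler_piMl.
Qed.

Lemma unit_circle_net (e : R) : 0 < e ->
  exists (n : nat) (c d : 'I_n.+1 -> R), (forall k, c k ^+ 2 + d k ^+ 2 = 1) /\
    forall a b, a ^+ 2 + b ^+ 2 = 1 -> exists k, `|a - c k| + `|b - d k| <= e.
Proof.
(* Angles are spaced by half of [e], because the cosine and the sine, both 1-Lipschitz, each
   contribute an error of at most [h]. *)
move=> e0; pose h := e / 2; have h0 : 0 < h by rewrite divr_gt0.
exists (Num.trunc (2 * pi / h)),
  (fun k => cos (k%:R * h)), (fun k => sin (k%:R * h)).
split=> [k|a b /unit_circle_param[t]]; first exact: cos2Dsin2.
rewrite in_itv/= => /andP[t0 t2pi] [<- <-].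
have th : 0 <= t / h by rewrite divr_ge0// ltW.
have kP : (Num.trunc (t / h) < (Num.trunc (2 * pi / h)).+1)%N.
  by rewrite ltnS; apply: le_truncn; rewrite ler_pM2r// invr_gt0.
exists (Ordinal kP) => /=.
have tk : `|t - (Num.trunc (t / h))%:R * h| <= h.
  have /andP[h1 h2] := truncn_itv th.
  move: h1 h2; rewrite ler_pdivlMr// ltr_pdivrMr// -natr1 mulrDl mul1r.
  by set k := _%:R * h; rewrite ler_norml => *; lra.
have cosl := @derive_le1_lipschitz cos (fun s => - sin s) (@is_derive_cos R)
  (fun s => ltac:(by rewrite normrN; exact: sin_max)).
have sinl := @derive_le1_lipschitz sin cos (@is_derive_sin R) (@cos_max R).
apply: le_trans (lerD (cosl _ _) (sinl _ _)) _.
by apply: le_trans (lerD tk tk) _; rewrite /h; lra.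
Qed.

End UnitCircle.

(** * The complex modulus over a Dedekind complete lattice *)

Section Modulus.
Variables (R : realType) (V : banachLatticeType R).
Hypothesis dcV : dedekind_complete V.
Implicit Types (x y w : V) (z : cplx V) (a b : R).

Lemma vle_scale_norm a x w : vle x w -> vle (- x) w -> vle (a *: x) (`|a| *: w).
Proof.
have [a0|a0] := ger0P a => xw Nxw; first exact: vle_scale.
by rewrite -[a *: x]opprK -scaleNr -scalerN; apply: vle_scale; rewrite // oppr_ge0 ltW.
Qed.

(** The set is bounded above by [vabs z.1 + vabs z.2], so by completeness its supremum exists and
    [supremum] does not return its default value. *)
Lemma cmodulus_isLub z : isLub
  [set (cos t *: z.1 + sin t *: z.2 : vord V) | t in `[0, 2 * pi]] (cmodulus z).
Proof.
have A0 : [set (cos t *: z.1 + sin t *: z.2 : vord V) | t in `[0, 2 * pi]] !=set0.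
  exists (cos 0 *: z.1 + sin 0 *: z.2), 0 => //=.
  by rewrite in_itv/= lexx mulr_ge0// pi_ge0.
have [s sP] : exists s, isLub
    [set (cos t *: z.1 + sin t *: z.2 : vord V) | t in `[0, 2 * pi]] s.
  apply: dcV => //; exists (vabs z.1 + vabs z.2) => _ [t _ <-].
  have h (c : R) (x : V) : `|c| <= 1 -> vle (c *: x) (vabs x).
    move=> c1; apply: vle_trans (vle_scale_norm _ (vjoin_l _ _) (vjoin_r _ _)) _.
    rewrite -vsubr_ge0 -[X in X - _]scale1r -scalerBl.
    by apply: vscale_ge0; [rewrite subr_ge0|exact: vabs_ge0].
  by apply: vle_add; apply: h; [exact: cos_max|exact: sin_max].
rewrite /cmodulus /supremum ifF; last exact/negbTE/set0P.
by case: xgetP => [y -> //|/(_ s)].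
Qed.

Lemma cmodulus_ub z a b : a ^+ 2 + b ^+ 2 = 1 ->
  vle (a *: z.1 + b *: z.2) (cmodulus z).
Proof.
move=> /unit_circle_param[t t2pi [<- <-]].
by apply: (cmodulus_isLub z).1; exists t.
Qed.

Lemma cmodulus_le z w :
  (forall a b, a ^+ 2 + b ^+ 2 = 1 -> vle (a *: z.1 + b *: z.2) w) ->
  vle (cmodulus z) w.
Proof.
move=> zw; apply: (cmodulus_isLub z).2 => _ [t _ <-].
by apply: zw; exact: cos2Dsin2.
Qed.

Lemma cmodulus_re z : vle (vabs z.1) (cmodulus z).
Proof.
have h a : a ^+ 2 = 1 -> vle (a *: z.1) (cmodulus z).
  move=> a1; have := @cmodulus_ub z a 0; rewrite scale0r addr0; apply.
  by rewrite a1 expr0n addr0.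
apply: vabs_le; first by rewrite -[z.1]scale1r; apply: h; rewrite expr1n.
by rewrite -scaleN1r; apply: h; rewrite sqrrN expr1n.
Qed.

Lemma cmodulus_im z : vle (vabs z.2) (cmodulus z).
Proof.
have h a : a ^+ 2 = 1 -> vle (a *: z.2) (cmodulus z).
  move=> a1; have := @cmodulus_ub z 0 a; rewrite scale0r add0r; apply.
  by rewrite a1 expr0n add0r.
apply: vabs_le; first by rewrite -[z.2]scale1r; apply: h; rewrite expr1n.
by rewrite -scaleN1r; apply: h; rewrite sqrrN expr1n.
Qed.

Lemma cmodulus_ge0 z : vle 0 (cmodulus z).
Proof. by apply: vle_trans (cmodulus_re z); exact: vabs_ge0. Qed.

Lemma cnorm_re z : `|z.1| <= cnorm z.
Proof.
by rewrite -vnorm_vabs; apply: vnorm_ge0_le; [exact: vabs_ge0|exact: cmodulus_re].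
Qed.

Lemma cnorm_im z : `|z.2| <= cnorm z.
Proof.
by rewrite -vnorm_vabs; apply: vnorm_ge0_le; [exact: vabs_ge0|exact: cmodulus_im].
Qed.

(** A rotation has constant coefficients, so it commutes with every [p i] and the modulus can be
    bounded block by block. *)
Lemma cmodulus_partition (I : finType) (p : I -> {linear V -> V}) (x y w : I -> V) :
  band_partition p ->
  (forall i a b, a ^+ 2 + b ^+ 2 = 1 -> vle (a *: x i + b *: y i) (w i)) ->
  vle (cmodulus (\sum_i p i (x i), \sum_i p i (y i))) (\sum_i p i (w i)).
Proof.
move=> pP xyw; apply: cmodulus_le => a b ab1 /=.
rewrite !scaler_sumr -big_split/=; apply: vle_sum => i _.
by rewrite -!linearZ -linearD/=; apply: band_partition_le => //; exact: xyw.
Qed.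

Lemma bigvjoin_ge (I : finType) (x0 : V) (F : I -> V) i :
  vle (F i) (\big[@vjoin R V/x0]_j F j).
Proof.
have : i \in index_enum I by rewrite mem_index_enum.
elim: (index_enum I) => [//|j s IH]; rewrite inE big_cons => /predU1P[->|/IH h].
  exact: vjoin_l.
exact: vle_trans (vjoin_r _ _).
Qed.

Lemma bigvjoin_le (I : finType) (x0 w : V) (F : I -> V) :
  vle x0 w -> (forall i, vle (F i) w) -> vle (\big[@vjoin R V/x0]_j F j) w.
Proof.
move=> x0w Fw; apply: (big_ind (fun x => vle x w)) => // x y xw yw.
by rewrite vjoinP xw.
Qed.

End Modulus.

(** * Suprema in the dual *)

Section DualLub.
Variables (R : realType) (V : banachLatticeType R).
Hypothesis dcV : dedekind_complete V.
Implicit Types (x y z u v w : V) (a r c : R) (f g h : dual V).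

Lemma dual_sum f (I : Type) (s : seq I) (P : pred I) (F : I -> V) :
  f (\sum_(i <- s | P i) F i) = \sum_(i <- s | P i) (f (F i) : R) :> R.
Proof. exact: (big_morph (fun x => f x : R) (dual_add f) (dual0 f)). Qed.

Lemma dual_vleP f g : reflect (forall x, vle 0 x -> (f x : R) <= g x) (vle f g).
Proof. exact: asboolP. Qed.

Lemma dual_ge0_le f x y : vle 0 f -> vle x y -> (f x : R) <= f y.
Proof.
move=> /dual_vleP f0; rewrite -vsubr_ge0 => /f0 h.
by have : (0 : R) <= f (y - x) := h; rewrite dual_sub subr_ge0.
Qed.

(** Test [f <= g] on [vabs x + x] and [- f <= g] on [vabs x - x]; the sum is twice the claim. *)
Lemma dual_le_abs f g x :
  vle f g -> vle (- f) g -> (f x : R) <= g (vabs x).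
Proof.
move=> /dual_vleP fg /dual_vleP Nfg.
have h1 : vle 0 (vabs x + x).
  by rewrite -[X in vabs x + X]opprK vsubr_ge0; exact: vjoin_r.
have h2 : vle 0 (vabs x - x) by rewrite vsubr_ge0; exact: vjoin_l.
have := fg _ h1; have := Nfg _ h2; rewrite dualN !dual_sub !dual_add; lra.
Qed.

(** Values at [x] of functionals glued from members of [B] along bands. Unlike in the
    Riesz-Kantorovich formula, the pieces of [x] come from band partitions, which are what the
    multi-dual norm tests. *)
Definition glued_values (B : set (dual V)) x : set R :=
  [set r | exists (I : finType) (q : I -> {linear V -> V}) (l : I -> dual V),
     [/\ band_partition q, forall i, B (l i) & r = \sum_i (l i (q i x) : R)]].

(* A band projection [Q] splits [y] as [(Q u + y') / 2] with [0 <= y' <= u]; this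
   halves the defect of additivity of the supremum of the glued functionals. *)
Lemma band_halving u y : vle 0 y -> vle y u ->
  exists2 Q : {linear V -> V}, band_projection Q &
    vle 0 (2 *: y - Q u) /\ vle (2 *: y - Q u) u.
Proof.
(* On the band of [Q], [2 y - Q u] is [2 y - u], which is positive there and at most [u] because
   [y <= u]. Off that band it is [2 y], which is at most [u] there. *)
move=> y0 yu; have [Q QP Qy] := band_projection_exists dcV (2 *: y - u).
have CP := band_projectionC QP.
exists Q => //; split.
  have -> : 2 *: y - Q u = vpos (2 *: y - u) + (2 *: y - Q (2 *: y)).
    by rewrite -Qy linearB/= [RHS]addrC addrA subrK.
  apply: vadd_ge0; first exact: vpos_ge0.
  by apply: (proj1 (CP.1 _ _)); exact: vscale_ge0.
rewrite -vsubr_ge0.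
have -> : u - (2 *: y - Q u) = 2 *: Q (u - y) + vneg (2 *: y - u).
  have -> : vneg (2 *: y - u) = vpos (2 *: y - u) - (2 *: y - u).
    by rewrite vposBneg [RHS]addrAC subrr add0r.
  rewrite -Qy -linearZ addrA -linearD/= scalerBr addrA subrK.
  by rewrite [2 *: u]scaler_nat mulr2n addrK !opprB addrCA.
apply: vadd_ge0; last exact: vneg_ge0.
by apply: vscale_ge0 => //; apply: (proj1 (QP.1 _ _)); rewrite vsubr_ge0.
Qed.

(** The supremum of the glued values is additive on the cone and extends to the least upper bound.
    The second clause keeps the part of this formula that is needed to estimate norms. *)
Lemma dual_lub (B : set (dual V)) h : B !=set0 -> (forall f, B f -> vle f h) ->
  exists2 lam : dual V, isLub (B : set (vord (dual V))) lam &
    forall x r, vle 0 x -> ubound (glued_values B x) r -> (lam x : R) <= r.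
Proof.
move=> [b0 Bb0] Bh; pose G := glued_values B; pose L x : R := sup (G x).
have G0 f x : B f -> G x (f x : R).
  move=> Bf; exists 'I_1, (fun i => if i == ord0 then idfun : {linear V -> V}
                          else \0 : {linear V -> V}), (fun=> f).
  by split => //; [exact: band_partition1|rewrite big_ord1].
have Gh x r : vle 0 x -> G x r -> r <= h x.
  move=> x0 [I [q [l [qP Bl ->]]]].
  rewrite -[x in leRHS](band_partition_sum qP) dual_sum; apply: ler_sum => i _.
  by apply/(dual_vleP (l i)); [exact: Bh|exact: band_partition_ge0].
have Gsup x : vle 0 x -> has_sup (G x).
  by move=> x0; split; [exists (b0 x); exact: G0|exists (h x) => r; exact: Gh].
have leL x r : vle 0 x -> G x r -> r <= L x.
  by move=> x0 Gr; apply: ub_le_sup => //; case: (Gsup x x0).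
have Lle x c : vle 0 x -> (forall r, G x r -> r <= c) -> L x <= c.
  by move=> x0 Gc; apply: ge_sup => //; case: (Gsup x x0).
have LD x y : vle 0 x -> vle 0 y -> L (x + y) <= L x + L y.
  move=> x0 y0; apply: (Lle); first exact: vadd_ge0.
  move=> _ [I [q [l [qP Bl ->]]]].
  rewrite (eq_bigr (fun i => (l i (q i x) : R) + (l i (q i y) : R))); last first.
    by move=> i _; rewrite linearD dual_add.
  rewrite big_split/=; apply: lerD; apply: (leL) => //; by exists I, q, l.
have LZ_le a x : 0 <= a -> vle 0 x -> L (a *: x) <= a * L x.
  move=> a0 x0; apply: (Lle); first exact: vscale_ge0.
  move=> _ [I [q [l [qP Bl ->]]]].
  rewrite (eq_bigr (fun i => a * (l i (q i x) : R))); last first.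
    by move=> i _; rewrite linearZ dual_scale.
  by rewrite -mulr_sumr ler_wpM2l//; apply: (leL) => //; exists I, q, l.
(* Superadditivity holds along a band projection, since partitions chosen separately for the two
   pieces can be glued. *)
have LQ Q x : band_projection Q -> vle 0 x -> L (Q x) + L (x - Q x) <= L x.
  move=> QP x0; have [Qx0 Qx] := QP.1 _ x0.
  rewrite -lerBrDr; apply: (Lle) => // _ [I [q [l [qP Bl ->]]]].
  rewrite lerBrDr -lerBrDl; apply: (Lle); first by rewrite vsubr_ge0.
  move=> _ [I' [q' [l' [q'P Bl' ->]]]]; rewrite lerBrDl.
  have [s [sP sl sr]] := band_partition_glue qP q'P QP.
  apply: (leL) => //; exists (I + I')%type, s,
    (fun k => match k with inl i => l i | inr i => l' i end).
  split=> //; first by case.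
  by rewrite big_sumType/=; congr (_ + _); apply: eq_bigr => i _; rewrite (sl, sr).
have Lsub u y : vle 0 y -> vle y u -> L y + L (u - y) <= L u.
  move=> y0 yu; have u0 : vle 0 u := vle_trans _ _ _ y0 yu.
  pose D := [set L y + L (u - y) - L u | y in [set y | vle 0 y /\ vle y u]].
  have D0 : D !=set0 by exists (L y + L (u - y) - L u), y.
  have Dsup : has_sup D.
    split=> //; exists (h u - L u) => _ [z [z0 zu] <-]; rewrite lerD2r.
    have -> : h u = h z + h (u - z) :> R by rewrite -dual_add addrC subrK.
    by apply: lerD; apply: (Lle) => [|r]; rewrite ?vsubr_ge0//; apply: Gh;
      rewrite ?vsubr_ge0.
  (* [z] is the mean of [Q u] and [z'], and [u - z] is the mean of [u - Q u] and [u - z']. By [LQ]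
     the pair from [Q] contributes no positive defect, which leaves half the defect of [z']. Hence
     [sup D <= sup D / 2], so [sup D <= 0]. *)
  have half z : vle 0 z -> vle z u -> L z + L (u - z) - L u <= sup D / 2.
    move=> z0 zu; have [Q QP [z'0 z'u]] := band_halving z0 zu.
    set z' := 2 *: z - Q u in z'0 z'u.
    have [Qu0 Qu] := QP.1 _ u0.
    have zE : z = 2^-1 *: (Q u + z') by rewrite addrC subrK scalerK.
    have uzE : u - z = 2^-1 *: ((u - Q u) + (u - z')).
      have e2 : u + u = 2 *: u by rewrite scaler_nat mulr2n.
      by rewrite addrACA -opprD (addrC (Q u)) subrK e2 -scalerBr scalerK.
    have hz : L z <= 2^-1 * (L (Q u) + L z').
      rewrite zE; apply: le_trans (LZ_le _ _ _ _) _ => //; first exact: vadd_ge0.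
      by rewrite ler_wpM2l// LD.
    have huz : L (u - z) <= 2^-1 * (L (u - Q u) + L (u - z')).
      rewrite uzE; apply: le_trans (LZ_le _ _ _ _) _ => //.
        by apply: vadd_ge0; rewrite vsubr_ge0.
      by rewrite ler_wpM2l// LD// vsubr_ge0.
    have hQ := LQ Q u QP u0.
    have hD : L z' + L (u - z') - L u <= sup D.
      by apply: ub_le_sup; [case: Dsup|exists z'].
    lra.
  have : sup D <= sup D / 2 by apply: ge_sup => // _ [z [z0 zu] <-]; exact: half.
  have := half y y0 yu; lra.
have LDE x y : vle 0 x -> vle 0 y -> L (x + y) = L x + L y.
  move=> x0 y0; apply/eqP; rewrite eq_le LD//=.
  by have := Lsub (x + y) x x0; rewrite vle_addr (addrC x) addrK; exact.
have LZE a x : 0 <= a -> vle 0 x -> L (a *: x) = a *: (L x : R^o).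
  have L00 : L 0 = 0 by have := LDE 0 0 (vle_refl _) (vle_refl _); rewrite addr0; lra.
  rewrite le_eqVlt => /predU1P[<- x0|a0 x0]; first by rewrite !scale0r L00.
  suff : L (a *: x) = a * L x by [].
  apply/eqP; rewrite eq_le LZ_le ?(ltW a0)//= -ler_pdivlMl//.
  have := @LZ_le a^-1 (a *: x).
  by rewrite scalerK ?gt_eqF// invr_ge0; apply; [exact: ltW|exact: vscale_ge0 _ _ (ltW a0) x0].
have [lam lamL] := cone_extension (W := R^o) LDE LZE.
have lam_lin : linear (lam : V -> R^o) by move=> a x y; exact: linearP.
(* On the cone [L] lies between [b0] and [h], hence this bound; the positive and negative parts of a
   general vector double it. *)
pose C := dual_norm b0 + dual_norm h.
have Lbnd x : vle 0 x -> `|L x| <= C * `|x|.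
  move=> x0; have h1 := leL x _ x0 (G0 b0 x Bb0).
  have h2 : L x <= h x by apply: (Lle) => // r; exact: Gh.
  rewrite ler_norml /C mulrDl.
  have := dual_normP b0 x; have := dual_normP h x.
  have := ler_norm (h x : R); have := ler_norm (- b0 x : R); rewrite normrN.
  have := mulr_ge0 (dual_norm_ge0 b0) (normr_ge0 x).
  have := mulr_ge0 (dual_norm_ge0 h) (normr_ge0 x).
  by move=> *; apply/andP; split; lra.
have C0 : 0 <= C by rewrite addr_ge0// dual_norm_ge0.
have lam_bnd x : `|lam x : R| <= (C *+ 2) * `|x|.
  rewrite {1}(vdecomp x) linearB/= !lamL ?vpos_ge0 ?vneg_ge0//.
  rewrite mulrnAl mulr2n; apply: le_trans (ler_normB _ _) _; apply: lerD.
    apply: le_trans (Lbnd _ (vpos_ge0 x)) _; rewrite ler_wpM2l//; exact: vnorm_vpos.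
  apply: le_trans (Lbnd _ (vneg_ge0 x)) _; rewrite ler_wpM2l//; exact: vnorm_vneg.
have lamP : dual_pred (lam : V -> R^o) := dual_predP lam_lin lam_bnd.
have lamE x : vle 0 x -> Dual lamP x = L x :> R by move=> x0; rewrite -lamL.
exists (Dual lamP); last by move=> x r x0 xr; rewrite lamE//; apply: (Lle).
split=> [f Bf|g gB]; apply/dual_vleP => x x0; rewrite lamE//.
  by apply: (leL) => //; exact: G0.
apply: (Lle) => // _ [I [q [l [qP Bl ->]]]].
rewrite -[x in leRHS](band_partition_sum qP) dual_sum; apply: ler_sum => i _.
by apply/(dual_vleP (l i)); [exact: gB|exact: band_partition_ge0].
Qed.

(** Makes the facts on the modulus available in the complexification of the dual. *)
Lemma dual_dedekind_complete : dedekind_complete (dual V).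
Proof.
move=> B B0 [h hB].
by have [lam lamP _] := @dual_lub B h B0 hB; exists lam.
Qed.

Lemma dual_lub_le (B : set (dual V)) (lam : dual V) x r :
  B !=set0 -> isLub (B : set (vord (dual V))) lam ->
  vle 0 x -> ubound (glued_values B x) r -> (lam x : R) <= r.
Proof.
move=> B0 [lamB lamB'] x0 xr.
have [mu [muB muB'] mur] := dual_lub B0 lamB.
have -> : lam = mu by apply: vle_anti_eq; [exact: lamB'|exact: muB'].
exact: mur.
Qed.

End DualLub.

(** * The modulus of a functional *)

Section Pairing.
Variables (R : realType) (V : banachLatticeType R).
Hypothesis dcV : dedekind_complete V.
Implicit Types (x y z u v w : V) (a b c d r t : R) (f g L : dual V).

Lemma lincomb2Z a b c x y : c *: (a *: x + b *: y) = (c * a) *: x + (c * b) *: y.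
Proof. by rewrite scalerDr !scalerA. Qed.

Lemma lincomb2D a b c d x y :
  (a *: x + b *: y) + (c *: x + d *: y) = (a + c) *: x + (b + d) *: y.
Proof. by rewrite addrACA -!scalerDl. Qed.

Lemma vle_lincomb x y w a b r : 0 < r ->
  (forall a b, a ^+ 2 + b ^+ 2 = 1 -> vle (a *: x + b *: y) w) ->
  a ^+ 2 + b ^+ 2 = r ^+ 2 -> vle (a *: x + b *: y) (r *: w).
Proof.
move=> r0 xyw abr; have rn0 := lt0r_neq0 r0.
rewrite -[a *: x + _](scalerKV rn0); apply: vle_scale; first exact: ltW.
rewrite lincomb2Z; apply: xyw.
by rewrite !exprMn -mulrDr abr -exprMn mulVf// expr1n.
Qed.

(** The points [(1, 0)] and [(-1, 0)] of the circle put [L] above both [f] and [- f]. *)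
Lemma circle_ub_ge0 f g L :
  (forall a b, a ^+ 2 + b ^+ 2 = 1 -> vle (a *: f + b *: g) L) -> vle 0 L.
Proof.
move=> fgL; apply/dual_vleP => z z0; suff : (0 : R) <= L z by [].
have /fgL/dual_vleP/(_ z z0) : (1 : R) ^+ 2 + 0 ^+ 2 = 1 by ring.
have /fgL/dual_vleP/(_ z z0) : (- 1 : R) ^+ 2 + 0 ^+ 2 = 1 by ring.
rewrite !dualD !dualZ; lra.
Qed.

(* Passing to [u = c x + d y] and [v = - d x + c y] rotates the picture so that
   [z = x + i y] becomes nearly positive, with small imaginary part [v]. *)
Lemma pairing_le_aligned f g L x y w c d t : 0 < t -> t <= 1 ->
  (forall a b, a ^+ 2 + b ^+ 2 = 1 -> vle (a *: f + b *: g) L) ->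
  (forall a b, a ^+ 2 + b ^+ 2 = 1 -> vle (a *: x + b *: y) w) ->
  vle 0 w -> c ^+ 2 + d ^+ 2 = 1 ->
  vle ((1 - t ^+ 2) *: w) (c *: x + d *: y) ->
  (f x : R) - g y <= (1 + 2 * t) * L w.
Proof.
move=> t0 t1 fgL xyw w0 cd1 wu.
set u := c *: x + d *: y in wu; pose v := (- d) *: x + c *: y.
have L0 := circle_ub_ge0 fgL.
have t2 : 0 <= 1 - t ^+ 2 by rewrite subr_ge0 expr_le1 // ltW.
have u0 : vle 0 u by apply: vle_trans wu; exact: vscale_ge0.
have xE : x = c *: u + (- d) *: v.
  have h1 : c * c + - d * - d = 1 by rewrite mulrNN -!expr2.
  have h0 : c * d + - d * c = 0 by ring.
  by rewrite !lincomb2Z lincomb2D h1 h0 scale1r scale0r addr0.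
have yE : y = d *: u + c *: v.
  have h1 : d * d + c * c = 1 by rewrite -!expr2 addrC.
  have h0 : d * c + c * - d = 0 by ring.
  by rewrite !lincomb2Z lincomb2D h1 h0 scale1r scale0r add0r.
have vw s : s ^+ 2 = 1 -> vle (s *: v) ((2 * t) *: w).
  move=> s1; have t20 : 0 < 2 * t by rewrite mulr_gt0.
  have tn0 := lt0r_neq0 t20.
  rewrite -[s *: v](scalerK tn0) -[(2 * t) *: w](scalerK tn0).
  apply: vle_scale; first by rewrite invr_ge0 ltW.
  (* The coefficients come from [(1 - t^2)^2 + (2 t)^2 = (1 + t^2)^2]. Subtracting [1 - t^2] times
     the hypothesis [wu] leaves [2 t s v <= (3 t^2 - t^4) w <= 4 t^2 w]. *)
  have : vle ((1 - t ^+ 2) *: u + (2 * t) *: (s *: v)) ((1 + t ^+ 2) *: w).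
    rewrite scalerA !lincomb2Z lincomb2D; apply: vle_lincomb xyw _.
      by rewrite ltr_pwDl// sqr_ge0.
    transitivity ((1 - t ^+ 2) ^+ 2 * (c ^+ 2 + d ^+ 2) +
      4 * t ^+ 2 * s ^+ 2 * (c ^+ 2 + d ^+ 2)); first ring.
    by rewrite cd1 s1; ring.
  move=> /vle_add/(_ (vle_opp (vle_scale t2 wu))).
  rewrite addrAC subrr add0r => h; apply: vle_trans h _.
  rewrite scalerA -scalerBl -vsubr_ge0 scalerA -scalerBl; apply: vscale_ge0 => //.
  have -> : 2 * t * (2 * t) - (1 + t ^+ 2 - (1 - t ^+ 2) * (1 - t ^+ 2)) =
    t ^+ 2 + t ^+ 2 * t ^+ 2 by ring.
  have tt0 := sqr_ge0 t; exact: addr_ge0 tt0 (mulr_ge0 tt0 tt0).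
have uw : vle u w by exact: xyw.
have vabsw : vle (vabs v) ((2 * t) *: w).
  apply: vabs_le; first by rewrite -[v]scale1r; apply: vw; rewrite expr1n.
  by rewrite -scaleN1r; apply: vw; rewrite sqrrN expr1n.
(* In the rotated coordinates [f x - g y] is [(c f - d g) u - (d f + c g) v]. The first term costs
   [L w], the second at most [2 t L w]. *)
have h1 : c * (f u : R) - d * (g u : R) <= L w.
  apply: le_trans (dual_ge0_le L0 uw).
  have /dual_vleP/(_ u u0) : vle (c *: f + (- d) *: g) L by apply: fgL; rewrite sqrrN.
  by rewrite dualD !dualZ mulNr.
have h2 : - (d * (f v : R) + c * (g v : R)) <= 2 * t * L w.
  have <- : L ((2 * t) *: w) = 2 * t * L w :> R by exact: dual_scale.
  apply: le_trans (dual_ge0_le L0 vabsw).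
  have := @dual_le_abs _ _ ((- d) *: f + (- c) *: g) L v.
  rewrite dualD !dualZ !mulNr -opprD; apply.
    by apply: fgL; rewrite !sqrrN addrC.
  rewrite opprD -!scaleNr !opprK; apply: fgL; by rewrite addrC.
rewrite {1}xE {1}yE !dual_add !dual_scale; lra.
Qed.

(** The left-hand side is the real part of [f + i g] at [x + i y]. A finite net of directions and
    [band_partition_max] cut the vector into bands on which a single rotation nearly attains the
    modulus; the estimates for aligned vectors are added up and [t] tends to [0]. *)
Lemma pairing_le f g L x y :
  (forall a b, a ^+ 2 + b ^+ 2 = 1 -> vle (a *: f + b *: g) L) ->
  (f x : R) - g y <= L (cmodulus (x, y)).
Proof.
move=> fgL; set w := cmodulus (x, y).
have w0 : vle 0 w by exact: cmodulus_ge0.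
have xyw a b : a ^+ 2 + b ^+ 2 = 1 -> vle (a *: x + b *: y) w.
  exact: (@cmodulus_ub _ _ dcV (x, y)).
suff key t : 0 < t -> t <= 1 -> (f x : R) - g y <= (1 + 2 * t) * L w.
  have Lw0 : 0 <= L w by have /dual_vleP := circle_ub_ge0 fgL; exact.
  (* This [s] makes [t = e / s] at most [1] and the excess [2 t L w] at most [e]. *)
  apply/ler_addgt0Pr => e e0; pose s := 2 * L w + 1 + e.
  have s0 : 0 < s by rewrite /s; lra.
  apply: le_trans (key (e / s) _ _) _; first by rewrite divr_gt0.
    by rewrite ler_pdivrMr// mul1r /s; lra.
  rewrite mulrDl mul1r lerD2l -mulrA mulrAC mulrA ler_pdivrMr// /s.
  by nra.
move=> t0 t1.
(* With mesh [t^2] the sum [m] of the best rotations satisfies [(1 - t^2) w <= m], as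
   [pairing_le_aligned] demands on each band. *)
have [n [c [d [cd1 net]]]] := unit_circle_net (exprn_gt0 2 t0).
have [q qP qu] := band_partition_max dcV ord0 (fun k => c k *: x + d k *: y).
set m := \sum_i _ in qu.
have qm k : q k m = q k (c k *: x + d k *: y).
  by rewrite band_partition_pick// (band_partition_proj k qP).2.
have wm : vle w (m + t ^+ 2 *: w).
  apply: cmodulus_le => // a b ab1 /=; have [k hk] := net a b ab1.
  have -> : a *: x + b *: y = (c k *: x + d k *: y) + ((a - c k) *: x + (b - d k) *: y).
    by rewrite lincomb2D [c k + _]addrC [d k + _]addrC !subrK.
  apply: vle_add => //.
  apply: (@vle_trans _ _ ((`|a - c k| + `|b - d k|) *: w)).
    rewrite [X in vle _ X]scalerDl; apply: vle_add; apply: vle_scale_norm.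
    - exact: vle_trans (vjoin_l _ _) (cmodulus_re dcV (x, y)).
    - exact: vle_trans (vjoin_r _ _) (cmodulus_re dcV (x, y)).
    - exact: vle_trans (vjoin_l _ _) (cmodulus_im dcV (x, y)).
    - exact: vle_trans (vjoin_r _ _) (cmodulus_im dcV (x, y)).
  rewrite -vsubr_ge0 -scalerBl; apply: vscale_ge0 => //.
  by rewrite subr_ge0.
rewrite -[x](band_partition_sum qP) -[y](band_partition_sum qP).
rewrite -[w](band_partition_sum qP) !dual_sum mulr_sumr -sumrB.
apply: ler_sum => k _; apply: (pairing_le_aligned (c := c k) (d := d k)) => //.
- move=> a b ab1; rewrite -!linearZ -linearD/=.
  by apply: band_partition_le => //; exact: xyw.
- exact: band_partition_ge0.
- rewrite -!linearZ -linearD -qm/=; apply: band_partition_le => //.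
  by rewrite scalerBl scale1r -vsubr_ge0 opprB addrA vsubr_ge0.
Qed.

End Pairing.

(** * Band decompositions of the complexification *)

Section BandDecomposition.
Variables (R : realType) (V : banachLatticeType R).
Hypothesis dcV : dedekind_complete V.
Implicit Types (x y u w : V) (z : cplx V).

Definition cplx_lift (I : Type) (p : I -> {linear V -> V}) : I -> cplx V -> cplx V :=
  fun i z => (p i z.1, p i z.2).

Lemma cplx_sumE (I : Type) (s : seq I) (Q : pred I) (F : I -> cplx V) :
  \sum_(i <- s | Q i) F i =
  (\sum_(i <- s | Q i) (F i).1, \sum_(i <- s | Q i) (F i).2).
Proof. by apply: (big_rec3 (fun a b c => c = (a, b))) => // i ? ? ? _ ->. Qed.

(** A band is an ideal, so it contains the real and imaginary parts of its elements. Uniqueness of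
    components then makes the projections act componentwise through real linear maps. *)
Lemma band_decompositionsP n (P : 'I_n -> cplx V -> cplx V) :
  band_decompositions P ->
  exists2 p : 'I_n -> {linear V -> V}, band_partition p & P = cplx_lift p.
Proof.
move=> [F dsF bF]; have uniq := direct_sum_uniq dsF.
have F0 i : F i 0 by have [] := direct_sum_subspace dsF i.
have ideal i x z : vle (vabs x) (cmodulus z) -> F i z -> F i (x, 0).
  by move=> xz; apply: (bF i).1.2; rewrite cmodulus_real.
have mem_re i z : F i z -> F i (z.1, 0) by apply/ideal/cmodulus_re.
have mem_im i z : F i z -> F i (z.2, 0) by apply/ideal/cmodulus_im.
have mem_c i x y : F i (x, 0) -> F i (y, 0) -> F i (x, y).
  move=> Fx Fy; have [_ FD FZ] := direct_sum_subspace dsF i.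
  have := FD _ _ Fx (FZ (0 +i* 1)%C _ Fy).
  suff -> : ((x, 0) : cplx V) + (0 +i* 1)%C *: ((y, 0) : cplx V) = (x, y) by [].
  by congr (_, _); rewrite /= ?scale0r ?scaler0 ?scale1r ?subr0 ?addr0 ?add0r.
pose f i x := (P i (x, 0)).1.
have Ff i x : F i (f i x, 0) by apply/mem_re/(direct_sum_mem dsF).
have sumf x : \sum_i f i x = x.
  have := direct_sum_proj dsF (x, 0); rewrite cplx_sumE => -[]; exact.
have PE i z : P i z = (f i z.1, f i z.2).
  rewrite -(uniq (fun i => (f i z.1, f i z.2))); last by move=> j; apply: mem_c.
  by rewrite cplx_sumE/= !sumf; case: z.
have f_uniq (w : 'I_n -> V) i : (forall j, F j (w j, 0)) -> f i (\sum_j w j) = w i.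
  move=> Fw; have := uniq (fun i => (w i, 0)) Fw i.
  by rewrite cplx_sumE PE => -[].
have f_lin i : linear (f i).
  move=> a x y; rewrite -[x in LHS]sumf -[y in LHS]sumf scaler_sumr -big_split/=.
  apply: (f_uniq (fun j => a *: f j x + f j y)) => j.
  have [_ FD FZ] := direct_sum_subspace dsF j.
  have := FD _ _ (FZ (a%:C)%C _ (Ff j x)) (Ff j y).
  suff -> : (a%:C)%C *: ((f j x, 0) : cplx V) + (f j y, 0) =
    (a *: f j x + f j y, 0) by [].
  by congr (_, _); rewrite /= ?scale0r ?scaler0 ?subr0 ?addr0.
pose p i : {linear V -> V} :=
  let m := GRing.isLinear.Build R V V *:%R (f i) (f_lin i) in HB.pack (f i) m.
exists p; last by apply/funext => i; apply/funext => z; exact: PE.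
split=> [i x x0|x|i j x ij]; last 2 first.
- exact: sumf.
- rewrite -[p j x]/(f j x) -[LHS]/(f i (f j x)).
  have -> : f j x = \sum_k (if k == j then f j x else 0).
    by rewrite -big_mkcond big_pred1_eq.
  rewrite f_uniq ?(negbTE ij)// => k; case: eqP => [->//|_]; exact: F0.
(* For positivity, [x >= 0] is split into [y i] with [0 <= y i <= vabs (f i x)]. The ideal property
   puts [y i] in the band [F i], so by uniqueness [f i x] is [y i]. *)
have xf : vle x (\sum_i vabs (f i x)).
  by rewrite -[x in vle x _]sumf; apply: vle_sum => j _; exact: vjoin_l.
have [y [xE yP]] := riesz_decomp_sum (fun j => vabs_ge0 (f j x)) x0 xf.
rewrite -[p i x]/(f i x) {1}xE f_uniq; first exact: (yP i).1.
move=> j; apply: (ideal _ _ (f j x, 0)) => //.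
by rewrite cmodulus_real (vabs_id (yP j).1); exact: (yP j).2.
Qed.

(** The summands are the fixed spaces of the [p i]. They are closed because a band projection is a
    contraction, and ideals because its complement kills whatever is dominated by a fixed vector. *)
Lemma cplx_lift_band_decompositions n (p : 'I_n -> {linear V -> V}) :
  band_partition p -> band_decompositions (cplx_lift p).
Proof.
move=> pP; have prj i := band_partition_proj i pP.
pose F i : set (cplx V) := [set z | p i z.1 = z.1 /\ p i z.2 = z.2].
have Fsub i : csubspace (F i).
  split=> [|z w [z1 z2] [w1 w2]|c z [z1 z2]]; first by split; rewrite linear0.
    by split; rewrite linearD/= ?z1 ?z2 ?w1 ?w2.
  by split; rewrite /= ?linearB ?linearD/= !linearZ/= z1 z2.
exists F.
  split.
  - exact: Fsub.
  - move=> i z Fz.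
    have key (x : V) : (forall e : R, 0 < e -> exists2 w : V, p i w = w & `|x - w| < e) ->
        p i x = x.
      move=> xw; apply/eqP; rewrite -subr_eq0 -normr_le0.
      apply/ler_addgt0Pr => e e0; rewrite add0r.
      have [w pw xwe] := xw (e / 2) (divr_gt0 e0 (ltr0Sn _ _)).
      have -> : p i x - x = p i (x - w) - (x - w).
        by rewrite linearB/= pw opprB addrA subrK.
      apply: le_trans (ler_normB _ _) _; rewrite [e]splitr; apply: lerD; last exact: ltW.
      by apply: le_trans (ltW xwe); exact: band_projection_norm.
    split; apply: key => e /Fz[w [w1 w2] zw].
      by exists w.1 => //; apply: le_lt_trans zw; exact: (cnorm_re dcV (z - w)).
    by exists w.2 => //; apply: le_lt_trans zw; exact: (cnorm_im dcV (z - w)).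
  - by move=> i z; split; exact: (prj i).2.
  - by move=> z; rewrite cplx_sumE/= !band_partition_sum//; case: z.
  - move=> w Fw i; rewrite cplx_sumE /cplx_lift/=.
    have e1 : \sum_j (w j).1 = \sum_j p j (w j).1.
      by apply: eq_bigr => j _; rewrite (Fw j).1.
    have e2 : \sum_j (w j).2 = \sum_j p j (w j).2.
      by apply: eq_bigr => j _; rewrite (Fw j).2.
    rewrite e1 e2 !band_partition_pick// !(prj i).2 (Fw i).1 (Fw i).2.
    by case: (w i).
move=> i; split; first split=> // z w zw [w1 w2].
  have Ww : vle (cmodulus w) (p i (cmodulus w)).
    apply: cmodulus_le => // a b ab1; rewrite -w1 -w2 -!linearZ -linearD/=.
    by apply: band_partition_le => //; exact: cmodulus_ub.
  have key x : vle (vabs x) (cmodulus z) -> p i x = x.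
    move=> xz; have C := band_projectionC (prj i).
    apply/esym/eqP; rewrite -subr_eq0 -normr_eq0 -vnorm_vabs normr_eq0; apply/eqP.
    apply: vle_anti_eq; last exact: vabs_ge0.
    apply: vle_trans (band_projection_vabs x C) _.
    apply: vle_trans (band_projection_le C (vle_trans _ _ _ xz zw)) _ => /=.
    by rewrite -vsubr_ge0 sub0r opprB vsubr_ge0.
  by split; apply: key; [exact: cmodulus_re|exact: cmodulus_im].
move=> D s [d0 Dd0] FD [sD lub]; have pd d : D d -> p i d = d by move=> /FD[].
split; last exact: linear0.
apply: vle_anti_eq; last first.
  apply: lub => d Dd; rewrite -[d](pd d Dd); apply: band_partition_le => //; exact: sD.
(* The inequality [p i x <= x] is available for positive [x] only, and [s] may have any sign; it is
   applied to [s - d0], with [d0] fixed by [p i]. *)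
have sd0 : vle (0 : V) ((s : V) - d0) by rewrite vsubr_ge0; exact: sD.
have := ((prj i).1 _ sd0).2; rewrite linearB/= (pd _ Dd0) => h.
have := vle_add2l (d0 : V) _ _ h.
by rewrite ![d0 + _]addrC !subrK.
Qed.

End BandDecomposition.

(** * The two multi-norms *)

Section LatticeMultinorm.
Variables (R : realType) (V : banachLatticeType R).
Hypothesis dcV : dedekind_complete V.
Implicit Types (z : cplx V).

Lemma cnorm_lift_le n (p : 'I_n.+1 -> {linear V -> V}) (x : 'I_n.+1 -> cplx V) :
  band_partition p ->
  cnorm (\sum_i cplx_lift p i (x i)) <= lattice_mnorm x.
Proof.
move=> pP; apply: vnorm_ge0_le; first exact: cmodulus_ge0.
set J := \big[@vjoin R V/_]_(i < n.+1) _; rewrite cplx_sumE -[J](band_partition_sum pP).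
apply: cmodulus_partition => // i a b ab1.
by apply: vle_trans (cmodulus_ub dcV (x i) ab1) _; exact: bigvjoin_ge.
Qed.

(** The partition is the maximal one for the moduli: [s] is above all of them, and [s] is at most
    the modulus of the glued vector [w]. *)
Lemma lattice_mnorm_attained n (x : 'I_n.+1 -> cplx V) :
  exists2 p : 'I_n.+1 -> {linear V -> V}, band_partition p &
    lattice_mnorm x <= cnorm (\sum_i cplx_lift p i (x i)).
Proof.
have [p pP pmax] := band_partition_max dcV ord0 (fun i => cmodulus (x i)).
exists p => //; set s := \sum_i _ in pmax; set w := \sum_i _.
have wE : w = (\sum_i p i (x i).1, \sum_i p i (x i).2) by exact: cplx_sumE.
have sw : vle s (cmodulus w).
  rewrite -[cmodulus w](band_partition_sum pP); apply: vle_sum => i _.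
  have prj := band_partition_proj i pP.
  (* The claim on block [i] is recast as an upper bound of the whole modulus of [x i], which can be
     checked on each rotation [u] by splitting it into [p i u] and [u - p i u]. *)
  suff : vle (cmodulus (x i))
      (p i (cmodulus w) + (cmodulus (x i) - p i (cmodulus (x i)))).
    by rewrite addrCA vle_addr vsubr_ge0.
  apply: cmodulus_le => // a b ab1; set u := _ + _.
  rewrite -[u](subrKC (p i u)); apply: vle_add.
    have -> : p i u = p i (a *: w.1 + b *: w.2).
      rewrite wE /u !linearD !linearZ/= !band_partition_pick//.
      by rewrite !prj.2.
    by apply: band_partition_le => //; exact: cmodulus_ub.
  by apply: (band_projection_le (band_projectionC prj)); exact: cmodulus_ub.
apply: vnorm_ge0_le.
  exact: vle_trans (cmodulus_ge0 dcV (x ord0)) (bigvjoin_ge _ _ ord0).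
by apply: bigvjoin_le => [|i]; apply: vle_trans (pmax _) sw.
Qed.

Lemma generated_mnorm_lattice n (x : 'I_n.+1 -> cplx V) :
  generated_mnorm (fun z : cplx V => (cnorm z)%:E)
    (@band_decompositions R V n.+1) x = (lattice_mnorm x)%:E.
Proof.
apply/eqP; rewrite eq_le; apply/andP; split.
  apply: ge_ereal_sup => _ [P /(band_decompositionsP dcV)[p pP ->] <-].
  by rewrite lee_fin; exact: cnorm_lift_le.
have [p pP xp] := lattice_mnorm_attained x.
apply: (@le_trans _ _ (cnorm (\sum_i cplx_lift p i (x i)))%:E); first by rewrite lee_fin.
apply: ereal_sup_ubound; exists (cplx_lift p) => //.
exact: cplx_lift_band_decompositions.
Qed.

End LatticeMultinorm.

(** * The absolute value of a complex number through its rotations *)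

Section ComplexNorm.
Variable R : realType.
Implicit Types (u : R[i]) (C : R).

(** The extremal [(c, d)] is [u] divided by its absolute value; for [u = 0] two opposite points give
    [0 <= C]. *)
Lemma normc_le u C : (forall c d : R, c ^+ 2 + d ^+ 2 = 1 ->
  c * complex.Re u + d * complex.Im u <= C) -> Normc.normc u <= C.
Proof.
case: u => a b /= uC; set r := Num.sqrt _.
have rE : r ^+ 2 = a ^+ 2 + b ^+ 2 by rewrite sqr_sqrtr// addr_ge0 ?sqr_ge0.
have [r0|r0] := eqVneq r 0.
  have h1 : (1 : R) ^+ 2 + 0 ^+ 2 = 1 by ring.
  have h2 : (- 1 : R) ^+ 2 + 0 ^+ 2 = 1 by ring.
  by rewrite r0; have := uC _ _ h1; have := uC _ _ h2; lra.
have := uC (a / r) (b / r); rewrite !exprMn -mulrDl -rE -exprMn divff// expr1n.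
move=> /(_ erefl); apply: le_trans.
by rewrite mulrAC -[b / r * b]mulrAC -mulrDl -!expr2 -rE expr2 mulfK.
Qed.

Lemma Re_le_normc (a b : R) : a <= Normc.normc (a +i* b)%C.
Proof.
apply: le_trans (ler_norm _) _.
by rewrite -sqrtr_sqr ler_wsqrtr// lerDl sqr_ge0.
Qed.

End ComplexNorm.

(** * The multi-dual multi-norm *)

Section DualMultinorm.
Variables (R : realType) (V : banachLatticeType R).
Hypothesis dcV : dedekind_complete V.
Implicit Types (z : cplx V) (phi : cdual V).

Lemma cdualE phi z : phi z =
  ((((cdual_cplx phi).1 z.1 : R) - (cdual_cplx phi).2 z.2)
   +i* (((cdual_cplx phi).2 z.1 : R) + (cdual_cplx phi).1 z.2))%C.
Proof.
have zE : z = ((z.1, 0) : cplx V) + (0 +i* 1)%C *: ((z.2, 0) : cplx V).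
  case: z => x y; congr (_, _) => /=;
    by rewrite ?scale0r ?scaler0 ?scale1r ?subr0 ?addr0 ?add0r.
rewrite [in LHS]zE linearD linearZ/=.
case: (phi (z.1, 0)) (phi (z.2, 0)) => [a b] [c d] /=.
by apply/eqP; rewrite eq_complex/=; apply/andP; split; apply/eqP; ring.
Qed.

Variables (n : nat) (phi : 'I_n.+1 -> cdual V).
Let f i := (cdual_cplx (phi i)).1.
Let g i := (cdual_cplx (phi i)).2.
Let L : dual V := \big[@vjoin R (dual V)/cmodulus (cdual_cplx (phi ord0))]_(i < n.+1)
  cmodulus (cdual_cplx (phi i)).

Lemma cdual_partitionE (p : 'I_n.+1 -> {linear V -> V}) z :
  (\sum_i ((phi i : cplx V -> R[i]) \o cplx_lift p i)) z =
  ((\sum_i ((f i (p i z.1) : R) - g i (p i z.2)))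
   +i* (\sum_i ((g i (p i z.1) : R) + f i (p i z.2))))%C.
Proof.
rewrite fct_sumE; under eq_bigr do rewrite /= cdualE.
by apply: (big_rec3 (fun a b c => a = (b +i* c)%C)) => // i a b c _ ->.
Qed.

Lemma cdual_lattice_ub i a b : a ^+ 2 + b ^+ 2 = 1 -> vle (a *: f i + b *: g i) L.
Proof.
move=> ab1; apply: vle_trans (bigvjoin_ge _ _ i).
exact: (cmodulus_ub (dual_dedekind_complete dcV)).
Qed.

(** After a rotation only a real part has to be bounded; [pairing_le] does so on each block with the
    same [L], and the bounds add up to [L (cmodulus z)]. *)
Lemma cdual_partition_le (p : 'I_n.+1 -> {linear V -> V}) z :
  band_partition p -> cnorm z <= 1 ->
  Normc.normc ((\sum_i ((phi i : cplx V -> R[i]) \o cplx_lift p i)) z)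
    <= `|L|.
Proof.
move=> pP z1; rewrite cdual_partitionE; apply: normc_le => c d cd1 /=.
have L0 := circle_ub_ge0 (@cdual_lattice_ub ord0).
have LP : L (cmodulus z) <= `|L|.
  apply: le_trans (ler_norm _) _; apply: le_trans (dual_normP _ _) _.
  by rewrite ler_piMr// dual_norm_ge0.
apply: le_trans LP.
rewrite -[cmodulus z](band_partition_sum pP) dual_sum !mulr_sumr -big_split/=.
apply: ler_sum => i _.
apply: (@le_trans _ _ (L (cmodulus ((p i z.1, p i z.2) : cplx V)))); last first.
  apply: dual_ge0_le => //; apply: cmodulus_le => // a b ab1 /=.
  by rewrite -!linearZ -linearD; apply: band_partition_le => //; exact: cmodulus_ub.
(* These are the real and imaginary parts of [(c - i d) (f i + i g i)]; a rotation permutes the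
   circle, so [L] still dominates. *)
have := @pairing_le R V dcV (c *: f i + d *: g i) (c *: g i - d *: f i) L
  (p i z.1) (p i z.2).
rewrite dualD dualB !dualZ => h; apply: le_trans (h _).
  by rewrite le_eqVlt; apply/orP; left; apply/eqP; ring.
move=> a b ab1.
have -> : a *: (c *: f i + d *: g i) + b *: (c *: g i - d *: f i) =
    (a * c - b * d) *: f i + (a * d + b * c) *: g i.
  rewrite addrC -scaleNr addrC (addrC (c *: g i)) !lincomb2Z lincomb2D.
  by rewrite mulrN.
apply: cdual_lattice_ub.
transitivity ((a ^+ 2 + b ^+ 2) * (c ^+ 2 + d ^+ 2)); first ring.
by rewrite ab1 cd1 mulr1.
Qed.

(** [L] is the least upper bound of the set [B] of real parts of rotated functionals, so
    [dual_lub_le] reduces the claim to glued values, each of which is realised by a band partition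
    and a vector of the unit ball. *)
Lemma cdual_lattice_le r :
  (forall (p : 'I_n.+1 -> {linear V -> V}) z, band_partition p -> cnorm z <= 1 ->
     Normc.normc ((\sum_i ((phi i : cplx V -> R[i]) \o cplx_lift p i)) z)
       <= r) ->
  `|L| <= r.
Proof.
move=> phir; pose B : set (dual V) := [set h | exists i a b,
  a ^+ 2 + b ^+ 2 = 1 /\ h = a *: f i + b *: g i].
have dcD := dual_dedekind_complete dcV.
have Blub : isLub (B : set (vord (dual V))) L.
  split=> [_ [i [a [b [ab1 ->]]]]|h hB]; first exact: cdual_lattice_ub.
  have ih i : vle (cmodulus (cdual_cplx (phi i))) h.
    by apply: (cmodulus_le dcD) => a b ab1; apply: hB; exists i, a, b.
  exact: bigvjoin_le.
have B0 : B !=set0.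
  by exists (1 *: f ord0 + 0 *: g ord0), ord0, 1, 0; split=> //; ring.
have L0 := circle_ub_ge0 (@cdual_lattice_ub ord0).
suff pos_le x : vle 0 x -> `|x| <= 1 -> (L x : R) <= r.
  rewrite dual_normE; apply: ge_sup; first by case: (dual_norm_has_sup L).
  move=> _ [x /= x1 <-]; apply: (@le_trans _ _ (L (vabs x))).
    rewrite ler_norml lerNl -dual_opp; apply/andP; split.
      by apply: dual_ge0_le => //; exact: vjoin_r.
    by apply: dual_ge0_le => //; exact: vjoin_l.
  by apply: pos_le; [exact: vabs_ge0|rewrite vnorm_vabs].
move=> x0 x1; apply: (dual_lub_le dcV B0 Blub x0).
move=> _ [I [q [l [qP Bl ->]]]].
have [lab labP] : {lab : I -> 'I_n.+1 * (R * R) & forall k,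
    (lab k).2.1 ^+ 2 + (lab k).2.2 ^+ 2 = 1 /\
    l k = (lab k).2.1 *: f (lab k).1 + (lab k).2.2 *: g (lab k).1}.
  apply: (@choice _ _ (fun k (ab : 'I_n.+1 * (R * R)) =>
    ab.2.1 ^+ 2 + ab.2.2 ^+ 2 = 1 /\
    l k = ab.2.1 *: f ab.1 + ab.2.2 *: g ab.1)) => k.
  by have [i [a [b [ab1 lk]]]] := Bl k; exists (i, (a, b)).
(* Blocks that use different rotations of the same [phi i] are merged; the rotations are moved into
   the vector [z], equal to [(c k - i d k) x] on block [k]. *)
have [p [pP pE]] := band_partition_coarsen (fun k => (lab k).1) qP.
pose c k := (lab k).2.1; pose d k := (lab k).2.2.
pose z : cplx V := (\sum_k q k (c k *: x), \sum_k q k (- d k *: x)).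
have z1 : cnorm z <= 1.
  apply: le_trans x1; apply: vnorm_ge0_le; first exact: cmodulus_ge0.
  rewrite -[x in vle _ x](band_partition_sum qP).
  apply: cmodulus_partition => // k a b ab1.
  rewrite !scalerA -scalerDl -vsubr_ge0 -[X in X - _]scale1r -scalerBl.
  apply: vscale_ge0 => //; rewrite subr_ge0.
  have cd1 : c k ^+ 2 + d k ^+ 2 = 1 := (labP k).1.
  (* The two squares add up to [2 - 2 (a c - b d)], whence the coefficient of [x] is at most [1]. *)
  have := sqr_ge0 (a - c k); have := sqr_ge0 (b + d k); nra.
apply: le_trans (phir p z pP z1); rewrite cdual_partitionE.
apply: le_trans (Re_le_normc _ _).
rewrite (partition_big (fun k => (lab k).1) xpredT)// le_eqVlt; apply/orP; left.
apply/eqP/eq_bigr => i _.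
rewrite !pE !dual_sum -sumrB; apply: eq_big => // k /eqP lki.
rewrite /z !band_partition_pick// !(band_partition_proj k qP).2.
have qZ e : q k (e *: x) = e *: q k x by rewrite linearZ.
by rewrite (labP k).2 lki dualD !dualZ !qZ !dual_scale mulNr opprK.
Qed.

Lemma multidual_mnorm_lattice :
  multidual_mnorm (@band_decompositions R V n.+1) phi =
  (lattice_mnorm (fun i => cdual_cplx (phi i)))%:E.
Proof.
rewrite /lattice_mnorm -/L; apply/eqP; rewrite eq_le; apply/andP; split.
  apply: ge_ereal_sup => _ [_ [P /(band_decompositionsP dcV)[p pP ->] <-] <-].
  apply: ge_ereal_sup => _ [z z1 <-]; rewrite lee_fin.
  exact: cdual_partition_le.
set M := multidual_mnorm _ _.
have leM p z : band_partition p -> cnorm z <= 1 -> ((Normc.normc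
    ((\sum_i ((phi i : cplx V -> R[i]) \o cplx_lift p i)) z))%:E <= M)%E.
  move=> pP z1; apply: (@le_trans _ _ (cdual_norm
      (\sum_i ((phi i : cplx V -> R[i]) \o cplx_lift p i)))).
    by apply: ereal_sup_ubound; exists z.
  apply: ereal_sup_ubound; exists (fun i h => h \o cplx_lift p i) => //.
  by exists (cplx_lift p) => //; exact: cplx_lift_band_decompositions.
(* A priori [M] is an extended real. The value [+oo] is harmless, and [-oo] is excluded by the
   trivial partition at the zero vector. *)
case: M leM => [r| |] leM; last 2 first.
- exact: leey.
- have /leM : band_partition (fun i : 'I_n.+1 => if i == ord0
      then idfun : {linear V -> V} else \0 : {linear V -> V}).
    exact: band_partition1.
  by move=> /(_ (0 : V, 0 : V)); rewrite cnorm_real normr0 => /(_ ler01).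
by rewrite lee_fin; apply: cdual_lattice_le => p z pP z1; rewrite -lee_fin; exact: leM.
Qed.

End DualMultinorm.

Theorem theorem7p58 (R : realType) (V : banachLatticeType R)
    (dedekind_completeV : dedekind_complete V) :
  (forall (n : nat) (x : 'I_n.+1 -> cplx V),
     generated_mnorm (fun z : cplx V => (cnorm z)%:E)
       (@band_decompositions R V n.+1) x = (lattice_mnorm x)%:E)
  /\
  (forall (n : nat) (phi : 'I_n.+1 -> cdual V),
     multidual_mnorm (@band_decompositions R V n.+1) phi =
     (lattice_mnorm (fun i => cdual_cplx (phi i)))%:E).
Proof.
split=> n x; first exact: generated_mnorm_lattice.
exact: multidual_mnorm_lattice.
Qed.
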